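(* Let $P_A$ be a combinatorial decision problem with $P_A\in\mathsf{NP}$. Then $P_A^{HDRR}$ with a linear number of $xor$-dependencies is in $\Sigma^p_3$.
   Context: A combinatorial decision problem $P_A$ has instances given by a finite universe $U$ and a tuple of relations $R=(R_1,\dots,R_r)$ with $R_1=U$, each a relation built from $U$, with a set $F(R)$ of feasible solutions; YES-instance iff $F(R)\neq\emptyset$. Universe elements and relation tuples are combinatorial elements. A scenario is an instance of $P_A$, obtained by activating/deactivating combinatorial elements (deactivating an element removes every relation element containing it). $H(A,B)=|A\triangle B|$. $P_A^{HDRR}$: given a base scenario $\sigma_0$, a set $\mathsf S$ of recovery scenarios and an integer $\kappa$, decide whether there are a feasible solution $s_0$ of $\sigma_0$ and for every $\sigma\in\mathsf S$ a feasible solution $s_\sigma$ of $\sigma$ with $H(s_0,s_\sigma)\le\kappa$ (over universe elements in the solutions). $xor$-dependency scenarios: the recovery scenario set is encoded by $(E',\{(E_{1,1},E_{1,2}),\dots,(E_{n,1},E_{n,2})\})$ with pairwise disjoint sets of combinatorial elements; it consists of all $\sigma=E'\cup E_1\cup\dots\cup E_n$ with $E_i\in\{E_{i,1},E_{i,2}\}$ for each $i$, where $E'$ is a fixed set of elements common to all scenarios. ''Linear number'' means $n$ is linear in the input size.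
   Formalization: ''P_A in NP'' is taken to include that membership of a given solution in F(R) is in NP; if only the set of YES-instances is in NP the claim fails, e.g. when F(R) is {∅} or {U} according to an undecidable property of R. *)

(* Defs.v *)
From HB Require Import structures.
From mathcomp Require Import all_boot all_order all_algebra.
From mathcomp Require Import finmap.

Set Implicit Arguments.
Unset Strict Implicit.
Unset Printing Implicit Defensive.

(** * Deterministic multitape Turing machines *)

(* [(l, r)]: the scanned cell is the first cell of [r], the cells of [l] are
   to its left, nearest first; [None] is the blank, and every cell that is not
   listed is blank, so the tape is infinite in both directions. *)
Definition tape (G : Type) : Type := (seq (option G) * seq (option G))%type.

Inductive move := MoveL | MoveN | MoveR.

Section Tapes.
Variable G : Type.
Implicit Types (t : tape G) (a : option G).

Definition read t : option G := head None t.2.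

Definition write a t : tape G := (t.1, a :: behead t.2).

Definition shift (m : move) t : tape G :=
  match m with
  | MoveL => (behead t.1, head None t.1 :: t.2)
  | MoveN => t
  | MoveR => (head None t.2 :: t.1, behead t.2)
  end.

Definition tape_of (x : seq G) : tape G := ([::], map Some x).
End Tapes.

(* [S] is the input alphabet; the tape alphabet is
   [option (S + tm_extra)], with [None] the blank.
   [tm_out q = Some b] means that [q] is a halting state, accepting if [b] is
   true and rejecting otherwise. *)
Record tm (S : finType) := TM {
  tm_tapes : nat;
  tm_extra : finType;
  tm_state : finType;
  tm_start : tm_state;
  tm_out : tm_state -> option bool;
  tm_delta : tm_state -> {ffun 'I_tm_tapes -> option (S + tm_extra)} ->
    tm_state * {ffun 'I_tm_tapes -> option (S + tm_extra) * move}
}.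

Section Runs.
Variables (S : finType) (M : tm S).

Definition config : Type :=
  (tm_state M * ('I_(tm_tapes M) -> tape (S + tm_extra M)))%type.

(* The inputs are given on separate tapes: the [i]-th one on tape [i]. *)
Definition tm_init (xs : seq (seq S)) : config :=
  (tm_start M, fun i : 'I_(tm_tapes M) => tape_of (map inl (nth [::] xs i))).

Definition tm_step (c : config) : config :=
  if tm_out c.1 is Some _ then c else
  let d := tm_delta c.1 [ffun i => read (c.2 i)] in
  (d.1, fun i => shift (d.2 i).2 (write (d.2 i).1 (c.2 i))).

Definition tm_result (xs : seq (seq S)) (n : nat) : option bool :=
  tm_out (iter n tm_step (tm_init xs)).1.

Definition tm_accepts (xs : seq (seq S)) : Prop :=
  exists n, tm_result xs n = Some true.

(* Any polynomial over the naturals is bounded by [n ^ d + d] for some [d]. *)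
Definition poly_time (m : nat) : Prop :=
  exists d : nat, forall xs : seq (seq S), size xs = m ->
    isSome (tm_result xs ((sumn (map size xs)) ^ d + d)).
End Runs.

(** * The polynomial hierarchy *)

(* [k] alternating quantifiers, the first one existential iff [ex], over
   strings of length at most [q], appended to the list of inputs of [V]. *)
Fixpoint alternation (S : finType) (q : nat) (V : seq (seq S) -> Prop)
    (ex : bool) (k : nat) (xs : seq (seq S)) : Prop :=
  match k with
  | 0 => V xs
  | k'.+1 =>
      if ex then exists u : seq S,
        size u <= q /\ alternation q V false k' (rcons xs u)
      else forall u : seq S,
        size u <= q -> alternation q V true k' (rcons xs u)
  end.

Definition in_Sigma (k : nat) (S : finType) (L : seq S -> Prop) : Prop :=
  exists2 M : tm S, poly_time M k.+1 &
  exists d : nat, forall x : seq S,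
    L x <-> alternation (size x ^ d + d) (@tm_accepts S M) true k [:: x].

Definition in_NP (S : finType) (L : seq S -> Prop) : Prop := in_Sigma 1 L.

(** * Combinatorial decision problems *)

Local Open Scope fset_scope.

(* Universe elements are named by binary words. *)
Definition word : Type := seq bool.

(* Combinatorial elements when there are [r] relations besides [U]:
   [inl u] is a universe element, [inr (i, t)] the tuple [t] of relation [i].
   Arities are left free. *)
Definition celem (r : nat) : choiceType := (word + 'I_r * seq word)%type.

Definition is_univ (r : nat) (e : celem r) : bool :=
  if e is inl _ then true else false.

(* All the universe elements contained in the relation element [e] are in
   [E]. *)
Definition supported (r : nat) (E : {fset celem r}) (e : celem r) : bool :=
  match e with
  | inl _ => true
  | inr (_, t) => all (fun u => (inl u : celem r) \in E) t
  end.

(* A tuple of relations (U, R_2, ..., R_(r+1)) is represented by the set of its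
   combinatorial elements, that is, by the disjoint union of the relations; it
   is an instance if the relations are over U. *)
Definition is_instance (r : nat) (R : {fset celem r}) : Prop :=
  forall e : celem r, e \in R -> supported R e.

(* [feasible R s] is only meaningful when [R] is an instance. *)
Record comb_problem := CombProblem {
  nrel : nat;
  feasible : {fset celem nrel} -> {fset celem nrel} -> Prop;
  feasible_sub : forall R s, is_instance R -> feasible R s -> s `<=` R
}.

(* The scenario in which exactly the elements of [E] are active: deactivating
   a universe element removes the tuples that contain it. *)
Definition scenario (r : nat) (E : {fset celem r}) : {fset celem r} :=
  [fset e in E | supported E e].

Definition symdiff (T : choiceType) (A B : {fset T}) : {fset T} :=
  (A `\` B) `|` (B `\` A).

Definition univ_part (r : nat) (s : {fset celem r}) : {fset celem r} :=
  [fset e in s | is_univ e].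

Definition hamming (r : nat) (s t : {fset celem r}) : nat :=
  #|` symdiff (univ_part s) (univ_part t)|.

Definition HDRR (P : comb_problem) (E0 : {fset celem (nrel P)})
    (Sc : {fset celem (nrel P)} -> Prop) (kappa : int) : Prop :=
  exists2 s0, feasible (scenario E0) s0 &
  forall E, Sc E -> exists2 s, feasible (scenario E) s &
    ((hamming s0 s)%:Z <= kappa)%R.

(** * xor-dependencies *)

Definition xor_disjoint (r : nat) (E' : {fset celem r})
    (D : seq ({fset celem r} * {fset celem r})) : bool :=
  pairwise (fun A B => [disjoint A & B])
    (E' :: flatten [seq [:: d.1; d.2] | d <- D]).

Definition xor_scenarios (r : nat) (E' : {fset celem r})
    (D : seq ({fset celem r} * {fset celem r})) (E : {fset celem r}) : Prop :=
  exists2 C : seq {fset celem r},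
    all2 (fun A d => (A == d.1) || (A == d.2)) C D &
    E = E' `|` \bigcup_(A <- C) A.

(** * Encodings *)

(* [inl b] is a bit, [inr true] an opening and [inr false] a closing
   bracket. *)
Definition sym : finType := (bool + bool)%type.

Definition brackets (x : seq sym) : seq sym :=
  inr true :: rcons x (inr false).

Definition enc_word (w : word) : seq sym := brackets (map inl w).

Definition enc_celem (r : nat) (e : celem r) : seq sym :=
  match e with
  | inl u => enc_word u
  | inr (i, t) =>
      brackets (enc_word (nseq i true) ++ flatten (map enc_word t))
  end.

(* A finite set is encoded by any list of its elements, in any order and
   possibly with repetitions. *)
Definition enc_set (r : nat) (l : seq (celem r)) : seq sym :=
  brackets (flatten (map (@enc_celem r) l)).

Definition enc_deps (r : nat) (D : seq (seq (celem r) * seq (celem r))) :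
    seq sym :=
  brackets (flatten [seq enc_set d.1 ++ enc_set d.2 | d <- D]).

(* Sign bit, then binary digits of the absolute value, least significant
   first. *)
Definition int_of_bits (sg : bool) (b : seq bool) : int :=
  let n := foldr (fun (c : bool) m => (c + m.*2)%N) 0 b in
  (if sg then - n%:Z else n%:Z)%R.

Definition to_fset (r : nat) (l : seq (celem r)) : {fset celem r} :=
  [fset e in l].

(** * Languages *)

Definition yes_lang (P : comb_problem) (w : seq sym) : Prop :=
  exists R : seq (celem (nrel P)),
    [/\ w = enc_set R, is_instance (to_fset R) &
        exists s, feasible (to_fset R) s].

Definition feasible_lang (P : comb_problem) (w : seq sym) : Prop :=
  exists R s : seq (celem (nrel P)),
    [/\ w = enc_set R ++ enc_set s, is_instance (to_fset R) &
        feasible (to_fset R) (to_fset s)].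

(* Membership of [P] in NP means that feasible solutions are what an NP
   verifier checks. The first conjunct alone says nothing about F(R) beyond its
   nonemptiness; it follows from the second one, since solutions are subsets of
   the instance. *)
Definition problem_in_NP (P : comb_problem) : Prop :=
  in_NP (yes_lang P) /\ in_NP (feasible_lang P).

(* [size D <= c * size w]: the number of xor-dependencies is linear in the
   input size, with constant [c]. *)
Definition HDRR_xor_lang (P : comb_problem) (c : nat) (w : seq sym) : Prop :=
  exists (E0 E' : seq (celem (nrel P)))
    (D : seq (seq (celem (nrel P)) * seq (celem (nrel P))))
    (sg : bool) (b : seq bool),
    let DS := [seq (to_fset d.1, to_fset d.2) | d <- D] in
    [/\ w = enc_set E0 ++ enc_set E' ++ enc_deps D ++ enc_word (sg :: b),
        xor_disjoint (to_fset E') DS,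
        (size D <= c * size w)%N &
        HDRR (to_fset E0) (xor_scenarios (to_fset E') DS)
          (int_of_bits sg b)].

(* Main.v *)
Require Import Defs.
From HB Require Import structures.
From mathcomp Require Import all_boot all_order all_algebra.
From mathcomp Require Import finmap zify.
From Stdlib Require Import FunctionalExtensionality.

(* The three quantifiers guess the base solution with an NP certificate of its
   feasibility, choose one set in every dependency, and guess a recovery
   solution with its certificate; what remains is a polynomial-time test.

   A concrete machine for this test is obtained from a class of functions
   between types coded by binary trees: those computed in polynomial time by
   while programs on finitely many stacks, each of which becomes the tape of a
   Turing machine. The class contains the case distinctions and is closed under
   composition and under iterations whose intermediate values remain of
   polynomial size, which suffices for folds over lists; the NP verifier of the
   problem is included by iterating its transition function. *)

Set Implicit Arguments.
Unset Strict Implicit.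
Unset Printing Implicit Defensive.
Import Order.TTheory GRing.Theory Num.Theory.

(** * Polynomial bounds *)

Inductive ispoly : (nat -> nat) -> Prop :=
| ispoly_const c : ispoly (fun=> c)
| ispoly_id : ispoly (fun n => n)
| ispoly_add p q : ispoly p -> ispoly q -> ispoly (fun n => p n + q n)
| ispoly_mul p q : ispoly p -> ispoly q -> ispoly (fun n => p n * q n).

Lemma ispoly_comp p q : ispoly p -> ispoly q -> ispoly (fun n => p (q n)).
Proof.
move=> Pp Pq; elim: Pp => [c||p1 p2 _ H1 _ H2|p1 p2 _ H1 _ H2] //.
- exact: ispoly_const.
- exact: ispoly_add.
- exact: ispoly_mul.
Qed.

Lemma ispoly_mono p : ispoly p -> {homo p : m n / m <= n}.
Proof.
elim=> [c||p1 p2 _ H1 _ H2|p1 p2 _ H1 _ H2] m n mn //=.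
- by rewrite leq_add ?H1 ?H2.
- by rewrite leq_mul ?H1 ?H2.
Qed.

Lemma ispoly_exp p d : ispoly p -> ispoly (fun n => p n ^ d).
Proof.
move=> Pp; elim: d => [|d IH]; first exact: ispoly_const.
rewrite (_ : (fun n => _) = fun n => p n * p n ^ d); first exact: ispoly_mul.
by apply: functional_extensionality => n; rewrite expnS.
Qed.

Lemma ispoly_leXD p : ispoly p -> exists d, forall n, p n <= n ^ d + d.
Proof.
elim=> [c||p1 p2 _ [a Ha] _ [b Hb]|p1 p2 _ [a Ha] _ [b Hb]].
- by exists c => n; rewrite leq_addl.
- by exists 1 => n; rewrite expn1 leq_addr.
- exists (a + b + 2) => -[|[|n]].
  + have := Ha 0; have := Hb 0; case: (a) => [|?]; case: (b) => [|?];
      rewrite ?expn0 ?exp0n //; lia.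
  + have := Ha 1; have := Hb 1; rewrite !exp1n; lia.
  have := Ha n.+2; have := Hb n.+2.
  have : 0 < n.+2 ^ a by rewrite expn_gt0.
  have : 0 < n.+2 ^ b by rewrite expn_gt0.
  have : 2 ^ 2 <= n.+2 ^ 2 by rewrite leq_exp2r.
  rewrite !expnD; move: (n.+2 ^ a) (n.+2 ^ b) (n.+2 ^ 2) => x y z zP yP xP.
  have : x + y <= x * y + 1 by nia.
  have : x * y * 4 <= x * y * z by rewrite leq_mul2l zP orbT.
  nia.
- exists (a + b + a * b + 2) => -[|[|n]].
  + apply: leq_trans (leq_mul (Ha 0) (Hb 0)) _.
    case: (a) => [|?]; case: (b) => [|?]; rewrite ?expn0 ?exp0n //; nia.
  + apply: leq_trans (leq_mul (Ha 1) (Hb 1)) _.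
    rewrite !exp1n; nia.
  apply: leq_trans (leq_mul (Ha n.+2) (Hb n.+2)) _.
  set N := n.+2.
  have ltX k : k < N ^ k by apply: ltn_expl.
  have H : N ^ (a + b + 2) <= N ^ (a + b + a * b + 2)
    by rewrite leq_exp2l // ; lia.
  have C : 4 <= N ^ 2 by rewrite -[4]/(2 ^ 2) leq_exp2r.
  move: (ltX a) (ltX b) H; rewrite !expnD.
  move: (N ^ a) (N ^ b) (N ^ 2) C => x y z C xa yb.
  have : (x + a) * (y + b) <= x * y * 4.
    have -> : x * y * 4 = (x + x) * (y + y) by lia.
    by apply: leq_mul; lia.
  nia.
Qed.

Definition pbnd (I : Type) (g h : I -> nat) : Prop :=
  exists2 p, ispoly p & forall i, g i <= p (h i).

Section PBnd.
Variable I : Type.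
Implicit Types g h k : I -> nat.

Lemma pbnd_const c h : pbnd (fun=> c) h.
Proof. by exists (fun=> c) => //; exact: ispoly_const. Qed.

Lemma pbnd_refl h : pbnd h h.
Proof. by exists (fun n => n) => //; exact: ispoly_id. Qed.

Lemma pbnd_le g g' h : (forall i, g i <= g' i) -> pbnd g' h -> pbnd g h.
Proof. by move=> le [p Pp H]; exists p => // i; apply: leq_trans (H i). Qed.

Lemma pbnd_add g1 g2 h :
  pbnd g1 h -> pbnd g2 h -> pbnd (fun i => g1 i + g2 i) h.
Proof.
move=> [p Pp Hp] [q Pq Hq]; exists (fun n => p n + q n) => [|i].
  exact: ispoly_add.
exact: leq_add.
Qed.

Lemma pbnd_mul g1 g2 h :
  pbnd g1 h -> pbnd g2 h -> pbnd (fun i => g1 i * g2 i) h.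
Proof.
move=> [p Pp Hp] [q Pq Hq]; exists (fun n => p n * q n) => [|i].
  exact: ispoly_mul.
exact: leq_mul.
Qed.

Lemma pbnd_comp p g h : ispoly p -> pbnd g h -> pbnd (fun i => p (g i)) h.
Proof.
move=> Pp [q Pq Hq]; exists (fun n => p (q n)) => [|i].
  exact: ispoly_comp.
exact: ispoly_mono (Hq i).
Qed.

Lemma pbnd_trans g h k : pbnd g h -> pbnd h k -> pbnd g k.
Proof.
move=> [p Pp Hp] H; apply: pbnd_le (pbnd_comp Pp H) => i; exact: Hp.
Qed.

Lemma pbnd_id_le g h : (forall i, g i <= h i) -> pbnd g h.
Proof. by move=> H; apply: pbnd_le H _; apply: pbnd_refl. Qed.
End PBnd.

Lemma pbnd_reindex (I J : Type) (r : J -> I) (g h : I -> nat) :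
  pbnd g h -> pbnd (fun j => g (r j)) (fun j => h (r j)).
Proof. by move=> [p Pp H]; exists p => // j; apply: H. Qed.

(** * Programs on registers holding strings *)

Section Language.
Variable S : finType.
Let G : finType := (S + bool)%type.

(* [Case i f] pops the first symbol of register [i], if there is one, and
   continues with the branch of [f] that it selects. *)
Inductive cmd : Type :=
| Skip
| Push of nat & G
| Case of nat & (option G -> cmd)
| Seq of cmd & cmd
| While of nat & cmd.

Definition regs : Type := nat -> seq G.

Definition upd (s : regs) (i : nat) (x : seq G) : regs :=
  fun j => if j == i then x else s j.

(* The number is an upper bound of the running time, not the exact one. *)
Inductive exec : cmd -> regs -> nat -> regs -> Prop :=
| exec_skip s : exec Skip s 1 s
| exec_push i g s : exec (Push i g) s 2 (upd s i (g :: s i))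
| exec_case i f s t s' :
    exec (f (ohead (s i))) (upd s i (behead (s i))) t s' ->
    exec (Case i f) s t.+1 s'
| exec_seq c1 c2 s t1 s1 t2 s2 :
    exec c1 s t1 s1 -> exec c2 s1 t2 s2 -> exec (Seq c1 c2) s (t1 + t2) s2
| exec_stop i c s : s i = [::] -> exec (While i c) s 1 s
| exec_loop i c s t1 s1 t2 s2 :
    s i != [::] -> exec c s t1 s1 -> exec (While i c) s1 t2 s2 ->
    exec (While i c) s (t1 + t2).+1 s2
| exec_weak c s t t' s' : exec c s t s' -> t <= t' -> exec c s t' s'.

Lemma exec_size c s t s' : exec c s t s' ->
  forall j, size (s' j) <= size (s j) + t.
Proof.
elim=> {c s t s'}.
- by move=> s j; rewrite leq_addr.
- by move=> i g s j; rewrite /upd; case: eqP => [->|_] /=; lia.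
- move=> i f s t s' _ IH j; move: (IH j); rewrite /upd.
  by case: eqP => [->|_]; rewrite ?size_behead; lia.
- by move=> c1 c2 s t1 s1 t2 s2 _ H1 _ H2 j; have := H1 j; have := H2 j; lia.
- by move=> i c s _ j; rewrite leq_addr.
- move=> i c s t1 s1 t2 s2 _ _ H1 _ H2 j.
  by have := H1 j; have := H2 j; lia.
- by move=> c s t t' s' _ H le j; have := H j; lia.
Qed.

Fixpoint maxreg (c : cmd) : nat :=
  match c with
  | Skip => 0
  | Push i _ => i
  | Case i f => maxn i (\max_g maxreg (f g))
  | Seq c1 c2 => maxn (maxreg c1) (maxreg c2)
  | While i c => maxn i (maxreg c)
  end.

(** * Compilation to Turing machines *)

Fixpoint cstate (c : cmd) : finType :=
  match c with
  | Skip => unit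
  | Push _ _ => bool
  | Case _ f => option {g : option G & cstate (f g)}
  | Seq c1 c2 => (cstate c1 + cstate c2)%type
  | While _ c => option (cstate c)
  end.

Fixpoint cstart (c : cmd) : cstate c :=
  match c with
  | Skip => tt
  | Push _ _ => false
  | Case _ f => None
  | Seq c1 c2 => inl (cstart c1)
  | While _ c => None
  end.

Definition action : Type := (nat * option G * move)%type.

Fixpoint cdelta (c : cmd) (r : nat -> option G) :
    cstate c -> option (cstate c) * action :=
  match c with
  | Skip => fun _ => (None, (0, r 0, MoveN))
  | Push i g => fun q : bool =>
      if q then (None, (i, Some g, MoveN)) else (Some true, (i, r i, MoveL))
  | Case i f => fun q : option {g : option G & cstate (f g)} =>
      match q with
      | None =>
          (Some (Some (Tagged (fun g => cstate (f g)) (cstart (f (r i))))),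
           (i, None, MoveR))
      | Some (existT g q) =>
          let d := cdelta r q in
          (omap (fun q' => Some (Tagged (fun g => cstate (f g)) q')) d.1, d.2)
      end
  | Seq c1 c2 => fun q : cstate c1 + cstate c2 =>
      match q with
      | inl q => let d := cdelta r q in
                 (Some (if d.1 is Some q' then inl q' else inr (cstart c2)),
                   d.2)
      | inr q => let d := cdelta r q in (omap inr d.1, d.2)
      end
  | While i c => fun q : option (cstate c) =>
      match q with
      | None => (if r i is Some _ then Some (Some (cstart c)) else None,
                 (i, r i, MoveN))
      | Some q => let d := cdelta r q in (Some d.1, d.2)
      end
  end.

Section Compile.
Variable K : nat.
Let tapes : Type := 'I_K -> tape G.

Definition reads (T : tapes) (j : nat) : option G :=
  if insub j is Some i then read (T i) else None.

Definition perform (a : action) (T : tapes) : tapes :=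
  fun i => if (i : nat) == a.1.1 then shift a.2 (write a.1.2 (T i))
           else write (read (T i)) (T i).

Inductive reach (c : cmd) : cstate c -> tapes -> nat -> tapes -> Prop :=
| reach_exit q T a :
    cdelta (reads T) q = (None, a) -> reach q T 1 (perform a T)
| reach_step q T q' a n T' :
    cdelta (reads T) q = (Some q', a) -> reach q' (perform a T) n T' ->
    reach q T n.+1 T'.

Definition holds (t : tape G) (x : seq G) : Prop :=
  exists a b, t = (nseq a None, map Some x ++ nseq b None).

Definition hold (T : tapes) (s : regs) : Prop := forall i, holds (T i) (s i).

Lemma holds_read t x : holds t x -> read t = ohead x.
Proof. by move=> [a [b ->]]; case: x => //=; case: b. Qed.

Lemma hold_reads T s i : hold T s -> i < K -> reads T i = ohead (s i).
Proof.
by move=> H iK; rewrite /reads insubT; apply: holds_read (H (Ordinal iK)).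
Qed.

Lemma holds_write t x : holds t x -> holds (write (read t) t) x.
Proof.
move=> [a [b ->]]; rewrite /write /read /=; case: x => [|g x] /=.
  by case: b => [|b]; [exists a, 1 | exists a, b.+1].
by exists a, b.
Qed.

Lemma holds_pop t x : holds t x -> holds (shift MoveR (write None t))
  (behead x).
Proof.
move=> [a [b ->]]; rewrite /write /read /shift /=; case: x => [|g x] /=.
  by exists a.+1, b.-1; case: b.
by exists a.+1, b.
Qed.

Lemma holds_push t x g : holds t x ->
  holds (write (Some g) (shift MoveL (write (read t) t))) (g :: x).
Proof.
move=> /holds_write; set u := write _ t => -[a [b ->]].
by rewrite /write /shift /=; exists a.-1, b; case: a.
Qed.

Lemma perform_refl T i s : hold T s -> i < K ->
  hold (perform (i, reads T i, MoveN) T) s.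
Proof.
move=> H iK j; rewrite /perform /=; case: eqP => [ji|_];
  last exact: holds_write.
rewrite /reads -ji valK; exact: holds_write.
Qed.

Lemma reach_seq1 c1 c2 (q : cstate c1) T n T1 n2 T2 :
  reach q T n T1 -> reach (c := c2) (cstart c2) T1 n2 T2 ->
  reach (c := Seq c1 c2) (inl q) T (n + n2) T2.
Proof.
move=> H H2.
have {}H2 : reach (c := Seq c1 c2) (inr (cstart c2)) T1 n2 T2.
  elim: H2 => {T1 T2 n2 H} [q0 T0 a e|q0 T0 q' a m T' e _ IH].
    by apply: reach_exit; rewrite /= e.
  by apply: reach_step IH; rewrite /= e.
elim: H H2 => {T n T1 q} [q T a e|q T q' a m T' e _ IH] H2.
  by apply: reach_step H2; rewrite /= e.
by apply: reach_step (IH H2); rewrite /= e.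
Qed.

Lemma reach_while i c (q : cstate c) T n T1 n2 T2 :
  reach q T n T1 -> reach (c := While i c) None T1 n2 T2 ->
  reach (c := While i c) (Some q) T (n + n2) T2.
Proof.
move=> H H2.
elim: H H2 => {T n T1 q} [q T a e|q T q' a m T' e _ IH] H2.
  by apply: reach_step H2; rewrite /= e.
by apply: reach_step (IH H2); rewrite /= e.
Qed.

Lemma reach_case i f g (q : cstate (f g)) T n T1 :
  reach q T n T1 ->
  reach (c := Case i f) (Some (Tagged (fun g => cstate (f g)) q)) T n T1.
Proof.
elim=> {T n T1 q} [q T a e|q T q' a m T' e _ IH].
  by apply: reach_exit; rewrite /= e.
by apply: reach_step IH; rewrite /= e.
Qed.

Lemma compile_correct c s t s' : exec c s t s' -> maxreg c < K ->
  forall T, hold T s ->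
  exists n T', [/\ n <= t, reach (cstart c) T n T' & hold T' s'].
Proof.
elim=> {c s t s'}.
- move=> s /= K0 T H; exists 1, (perform (0, reads T 0, MoveN) T).
  by split=> //; [exact: reach_exit | exact: perform_refl].
- move=> i g s /= iK T H; pose T1 := perform (i, reads T i, MoveL) T.
  exists 2, (perform (i, Some g, MoveN) T1); split=> //.
    by apply: (@reach_step (Push i g) _ _ true) => //; apply: reach_exit.
  move=> j; rewrite /T1 /perform /upd /=.
  case: eqP => [ji|_]; last by do 2!apply: holds_write.
  by rewrite /reads -ji valK; exact: holds_push.
- move=> i f s t s' _ IH /=; rewrite gtn_max => /andP [iK fK] T H.
  have fK' : maxreg (f (ohead (s i))) < K.
    exact: leq_ltn_trans (leq_bigmax (ohead (s i))) fK.
  have H1 : hold (perform (i, None, MoveR) T) (upd s i (behead (s i))).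
    move=> j; rewrite /perform /upd /=.
    by case: eqP => [<-|_]; [exact: holds_pop | exact: holds_write].
  have [n [T' [nt R HT']]] := IH fK' _ H1.
  exists n.+1, T'; split=> //.
  apply: reach_step (reach_case i R).
  by rewrite /= (hold_reads H).
- move=> c1 c2 s t1 s1 t2 s2 _ H1 _ H2 /=.
  rewrite gtn_max => /andP [k1 k2] T H.
  have [n1 [T1 [l1 R1 E1]]] := H1 k1 _ H.
  have [n2 [T2 [l2 R2 E2]]] := H2 k2 _ E1.
  exists (n1 + n2), T2; split=> //; first exact: leq_add.
  exact: reach_seq1 R1 R2.
- move=> i c s si /=; rewrite gtn_max => /andP [iK _] T H.
  exists 1, (perform (i, reads T i, MoveN) T).
  split=> //; last exact: perform_refl.
  by apply: reach_exit; rewrite /= (hold_reads H) // si.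
- move=> i c s t1 s1 t2 s2 si _ H1 _ H2 K2 T H.
  have := K2; rewrite /= gtn_max => /andP [iK k1].
  have [n1 [T1 [l1 R1 E1]]] := H1 k1 _ (perform_refl H iK).
  have [n2 [T2 [l2 R2 E2]]] := H2 K2 _ E1.
  exists (n1 + n2).+1, T2; split=> //; first by rewrite ltnS leq_add.
  apply: reach_step (reach_while R1 R2).
  by rewrite /= (hold_reads H) //; case: (s i) si.
- move=> c s t t' s' _ IH le cK T H.
  have [n [T' [l1 R1 E1]]] := IH cK _ H.
  by exists n, T'; split=> //; apply: leq_trans le.
Qed.
End Compile.

(* The machine stops after inspecting the first symbol of register [o]; the
   state [inr None] is reached when the program ends. *)
Section Machine.
Variables (c : cmd) (o : nat).
Let K := (maxn (maxreg c) o).+1.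

Definition lookup (r : {ffun 'I_K -> option G}) (j : nat) : option G :=
  if insub j is Some i then r i else None.

Definition cmachine : tm S := @TM S K bool (cstate c + option bool)%type
  (inl (cstart c))
  (fun q => if q is inr b then b else None)
  (fun q r =>
    match q with
    | inl q => let d := cdelta (lookup r) q in
        (if d.1 is Some q' then inl q' else inr None,
         [ffun i : 'I_K => if (i : nat) == d.2.1.1 then (d.2.1.2, d.2.2)
                    else (r i, MoveN)])
    | inr _ => (inr (Some (lookup r o == Some (inr true))),
                [ffun i : 'I_K => (r i, MoveN)])
    end).

Lemma cmachine_step (q : cstate c) (T : 'I_K -> tape G) :
  let d := cdelta (reads T) q in
  tm_step ((inl q, T) : config cmachine) =
  (if d.1 is Some q' then inl q' else inr None, perform d.2 T).
Proof.
rewrite /tm_step /=.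
have -> : lookup [ffun i => read (T i)] = reads T.
  apply: functional_extensionality => j; rewrite /lookup /reads.
  by case: insubP => // i _ _; rewrite ffunE.
congr pair; apply: functional_extensionality => i.
by rewrite !ffunE /perform; case: ifP => _; rewrite ?ffunE.
Qed.

Lemma cmachine_reach (q : cstate c) (T : 'I_K -> tape G) n T' :
  reach q T n T' ->
  iter n (@tm_step S cmachine) (inl q, T) = (inr None, T').
Proof.
elim=> {q T n T'} [q T a e|q T q' a n T' e _ IH].
  by rewrite [iter _ _ _]cmachine_step e.
by rewrite iterSr cmachine_step e.
Qed.

Lemma tm_stepK (M : tm S) (x : config M) n : tm_out x.1 -> iter n (@tm_step S M)
  x = x.
Proof. by move=> H; elim: n => //= n ->; rewrite /tm_step; case: tm_out H. Qed.

Lemma cmachine_result xs t s' :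
  exec c (fun i => map inl (nth [::] xs i)) t s' ->
  forall n, t < n ->
  @tm_result S cmachine xs n = Some (ohead (s' o) == Some (inr true)).
Proof.
move=> E n tn.
have cK : maxreg c < K by rewrite ltnS leq_maxl.
have H0 : hold (@tm_init S cmachine xs).2 (fun i => map inl (nth [::] xs i)).
  by move=> i; exists 0, 0; rewrite /tape_of cats0.
have [m [T' [mt R HT']]] := compile_correct E cK H0.
rewrite /tm_result -(subnK (leq_ltn_trans mt tn : m < n)) iterD iterS.
rewrite (cmachine_reach R : iter m _ (tm_init _ _) = _).
set y := tm_step _.
have ey : tm_out y.1 = Some (ohead (s' o) == Some (inr true)).
  rewrite /y /tm_step /=; congr Some; congr (_ == _).
  rewrite -(hold_reads HT') //; last by rewrite ltnS leq_maxr.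
  by rewrite /lookup /reads; case: insubP => // i _ _; rewrite ffunE.
by rewrite tm_stepK ey.
Qed.
End Machine.
End Language.

(** * Trees in registers *)

Inductive tree : Type := Leaf | Node of tree & tree.

Fixpoint tsize (t : tree) : nat :=
  if t is Node a b then (tsize a + tsize b).+1 else 1.

Lemma tsize_gt0 t : 0 < tsize t. Proof. by case: t. Qed.

Section Trees.
Variable S : finType.
Local Notation G := (S + bool)%type.
Implicit Types (s : regs S) (L : seq (seq G)) (c : cmd S).

(* Prefix notation. *)
Fixpoint str (t : tree) : seq G :=
  if t is Node a b then inr true :: str a ++ str b else [:: inr false].

Lemma size_str t : size (str t) = tsize t.
Proof. by elim: t => //= a IHa b IHb; rewrite size_cat IHa IHb. Qed.

(* The registers below [m] are those of [s], the next ones are listed in [L],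
   and the others are empty. *)
Definition st s (m : nat) L : regs S :=
  fun j => if j < m then s j else nth [::] L (j - m).

Lemma st_nth s m L k : st s m L (m + k) = nth [::] L k.
Proof. by rewrite /st ltnNge leq_addr /= addKn. Qed.

Lemma upd_st s m L k x : upd (st s m L) (m + k) x = st s m (set_nth [::] L k x).
Proof.
apply: functional_extensionality => j; rewrite /upd /st nth_set_nth /=.
case: ltnP => mj; first by case: eqP => // e; lia.
by congr (if _ then _ else _); lia.
Qed.

Lemma st_ext s m L L' : (forall k, nth [::] L k = nth [::] L' k) ->
  st s m L = st s m L'.
Proof. by move=> H; apply: functional_extensionality => j; rewrite /st H. Qed.

Lemma st_cat s m k L L' : size L = k ->
  st (st s m L) (m + k) L' = st s m (L ++ L').
Proof.
move=> <-; apply: functional_extensionality => j; rewrite /st nth_cat.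
case: (ltnP j m) => jm; first by rewrite ltn_addr.
by rewrite ltn_subLR // subnDA; case: ifP.
Qed.

Lemma nth_set L i x n :
  nth [::] (set_nth [::] L i x) n = if n == i then x else nth [::] L n.
Proof. by rewrite nth_set_nth. Qed.

Lemma exec_eq c s t s1 s2 : exec c s t s1 -> s1 = s2 -> exec c s t s2.
Proof. by move=> H <-. Qed.

Lemma exec_le c s t t' s1 s2 :
  exec c s t s1 -> s1 = s2 -> t <= t' -> exec c s t' s2.
Proof. by move=> H <-; apply: exec_weak. Qed.

Lemma exec_seq_le c1 c2 s t1 s1 t2 s2 t :
  exec c1 s t1 s1 -> exec c2 s1 t2 s2 -> t1 + t2 <= t ->
  exec (Seq c1 c2) s t s2.
Proof. by move=> H1 H2; apply: exec_weak; apply: exec_seq H1 H2. Qed.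

Lemma exec_push_st s m L k g :
  exec (Push (m + k) g) (st s m L) 2
       (st s m (set_nth [::] L k (g :: nth [::] L k))).
Proof. by rewrite -upd_st -(st_nth s m); apply: exec_push. Qed.

Lemma exec_case_st s m L k f t s' :
  exec (f (ohead (nth [::] L k)))
       (st s m (set_nth [::] L k (behead (nth [::] L k)))) t s' ->
  exec (Case (m + k) f) (st s m L) t.+1 s'.
Proof. by rewrite -upd_st -(st_nth s m); apply: exec_case. Qed.

Lemma exec_sub (m k : nat) c x T y s L : size L = k ->
  (forall s, exec c (st s (m + k) [:: x]) T (st s (m + k) [:: y])) ->
  exec c (st s m (L ++ [:: x])) T (st s m (L ++ [:: y])).
Proof. by move=> e H; have := H (st s m L); rewrite !st_cat. Qed.

Definition mv (i j : nat) : cmd S :=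
  While i (Case i (fun o => if o is Some g then Push j g else Skip S)).

Lemma exec_mv i j s : i != j ->
  exec (mv i j) s (4 * size (s i) + 1)
       (upd (upd s i [::]) j (rev (s i) ++ s j)).
Proof.
move=> ij; move e : (s i) => x; elim: x s e => [|g x IH] s e.
  apply: exec_eq (exec_stop _ e) _; apply: functional_extensionality => k.
  by rewrite /upd; case: eqP => [->|_] //; case: eqP => [->|_].
set s1 := upd (upd s i x) j (g :: s j).
have e1 : s1 i = x by rewrite /s1 /upd (negPf ij) eqxx.
apply: exec_le (exec_loop _ _ (IH _ e1)) _ _; first by rewrite e.
- apply: exec_case; rewrite e /=; apply: exec_eq (exec_push _ _ _) _.
  by rewrite /s1 /upd eq_sym (negPf ij).
- apply: functional_extensionality => k; rewrite /s1 /upd eqxx.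
  by case: eqP => // _; [rewrite rev_cons cat_rcons | case: eqP].
- rewrite /=; lia.
Qed.

Lemma exec_mv_st s m L i j : i != j ->
  exec (mv (m + i) (m + j)) (st s m L) (4 * size (nth [::] L i) + 1)
    (st s m (set_nth [::] (set_nth [::] L i [::]) j
               (rev (nth [::] L i) ++ nth [::] L j))).
Proof.
move=> ij; rewrite -!upd_st -!(st_nth s m); apply: exec_mv.
by rewrite eqn_add2l.
Qed.

Definition cp (i j k : nat) : cmd S :=
  While i (Case i (fun o =>
    if o is Some g then Seq (Push j g) (Push k g) else Skip S)).

Lemma exec_cp_st s m L i j k : uniq [:: i; j; k] ->
  exec (cp (m + i) (m + j) (m + k)) (st s m L) (6 * size (nth [::] L i) + 1)
    (st s m (set_nth [::] (set_nth [::] (set_nth [::] L i [::]) j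
               (rev (nth [::] L i) ++ nth [::] L j)) k
               (rev (nth [::] L i) ++ nth [::] L k))).
Proof.
rewrite /= !inE negb_or andbT => /andP [/andP [ij ik] jk].
have ji : (j == i) = false by rewrite eq_sym (negPf ij).
have ki : (k == i) = false by rewrite eq_sym (negPf ik).
have kj : (k == j) = false by rewrite eq_sym (negPf jk).
move e : (nth [::] L i) => x; elim: x L e => [|g x IH] L e.
  apply: exec_eq (exec_stop _ _) _; first by rewrite st_nth.
  by apply: st_ext => n; rewrite !nth_set; do !case: eqP => [->|_].
apply: exec_le (exec_loop _ _ (IH _ _)) _ _; first by rewrite st_nth e.
- apply: exec_case_st; rewrite e /=.
  by apply: exec_seq; apply: exec_push_st.
- by rewrite !nth_set (negPf ij) (negPf ik) eqxx.
- apply: st_ext => n; rewrite !nth_set !eqxx ji ki kj (negPf jk).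
  rewrite rev_cons !cat_rcons.
  by case: (n =P k) => // _; case: (n =P j) => // _; case: (n =P i).
- rewrite /=; lia.
Qed.

Definition clear (i : nat) : cmd S := While i (Case i (fun=> Skip S)).

Lemma exec_clear_st s m L i :
  exec (clear (m + i)) (st s m L) (3 * size (nth [::] L i) + 1)
    (st s m (set_nth [::] L i [::])).
Proof.
move e : (nth [::] L i) => x; elim: x L e => [|g x IH] L e.
  apply: exec_eq (exec_stop _ _) _; first by rewrite st_nth.
  by apply: st_ext => n; rewrite nth_set; case: eqP => [->|].
apply: exec_le (exec_loop _ _ (IH _ _)) _ _; first by rewrite st_nth e.
- by apply: exec_case_st; apply: exec_skip.
- by rewrite nth_set eqxx e.
- by apply: st_ext => n; rewrite !nth_set; case: eqP.
- rewrite /=; lia.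
Qed.

(* Appends the content of register [i] in front of that of [j], through the
   empty register [k]. *)
Definition app (i j k : nat) : cmd S := Seq (mv i k) (mv k j).

Lemma exec_app_st s m L i j k : uniq [:: i; j; k] -> nth [::] L k = [::] ->
  exec (app (m + i) (m + j) (m + k)) (st s m L) (8 * size (nth [::] L i) + 2)
    (st s m (set_nth [::] (set_nth [::] L i [::]) j
               (nth [::] L i ++ nth [::] L j))).
Proof.
rewrite /= !inE negb_or andbT => /andP [/andP [ij ik] jk] ek.
have ji : (j == i) = false by rewrite eq_sym (negPf ij).
have kj : (k == j) = false by rewrite eq_sym (negPf jk).
have ki : (k == i) = false by rewrite eq_sym (negPf ik).
apply: exec_seq_le (exec_mv_st _ _ _ ik) (exec_eq (exec_mv_st _ _ _ _) _) _.
- by rewrite kj.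
- apply: st_ext => n; rewrite !nth_set !eqxx ji (negPf jk) ek cats0 revK.
  case: (n =P j) => // _; case: (n =P k) => [->|_]; first by rewrite ki.
  by case: (n =P i).
- by rewrite !nth_set !eqxx ek cats0 size_rev; lia.
Qed.

Ltac solve_st := apply: st_ext => -[|[|[|[|[|?]]]]];
  rewrite /= ?nth_nil ?cats0 ?revK //.

Lemma exec_src c s s1 t s' : exec c s1 t s' -> s = s1 -> exec c s t s'.
Proof. by move=> H ->. Qed.

Definition dup (i j k : nat) : cmd S := Seq (mv i k) (cp k i j).

Lemma exec_dup_st s m L i j k : uniq [:: i; j; k] ->
  nth [::] L k = [::] -> nth [::] L j = [::] ->
  exec (dup (m + i) (m + j) (m + k)) (st s m L) (10 * size (nth [::] L i) + 2)
    (st s m (set_nth [::] L j (nth [::] L i))).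
Proof.
move=> ijk ek ej; have ijk' : uniq [:: k; i; j].
  by rewrite -(rot_uniq 1).
have := ijk; rewrite /= !inE negb_or andbT => /andP [/andP [ij ik] jk].
have ji : (j == i) = false by rewrite eq_sym (negPf ij).
have kj : (k == j) = false by rewrite eq_sym (negPf jk).
have ki : (k == i) = false by rewrite eq_sym (negPf ik).
apply: exec_seq_le (exec_mv_st _ _ _ ik) (exec_eq (exec_cp_st _ _ _ ijk') _) _.
- apply: st_ext => n.
  rewrite !nth_set !eqxx ji (negPf ik) (negPf jk).
  rewrite ek ej !cats0 !revK.
  case: (n =P j) => // _; case: (n =P i) => [->|] // _.
  by case: (n =P k) => [->|].
- by rewrite !nth_set !eqxx ek cats0 size_rev; lia.
Qed.

(* Moves the tree in front of register [m] to register [m + 2], reversed; the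
   length of register [m + 1] is the number of trees that are still to be
   read. *)
Definition split_loop (m : nat) : cmd S :=
  While (m + 1) (Case (m + 0) (fun o =>
    if o is Some g then
      Seq (Push (m + 2) g)
          (if g == inr true then Push (m + 1) (inr true)
           else Case (m + 1) (fun=> Skip S))
    else Skip S)).

Definition split (m : nat) : cmd S :=
  Seq (Push (m + 1) (inr true)) (split_loop m).

Lemma exec_split_loop t s m r g n acc T s' :
  exec (split_loop m) (st s m [:: r; n; rev (str t) ++ acc]) T s' ->
  exec (split_loop m) (st s m [:: str t ++ r; g :: n; acc])
    (T + 6 * tsize t) s'.
Proof.
elim: t r g n acc T => [|a IHa b IHb] r g n acc T H.
- apply: exec_le (exec_loop _ _ H) (erefl s') _; first by rewrite st_nth.
    apply: exec_case_st; apply: exec_seq; first exact: exec_push_st.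
    by apply: exec_case_st; apply: exec_skip.
  by rewrite /=; lia.
- have H2 : exec (split_loop m)
    (st s m [:: str a ++ str b ++ r; [:: inr true, g & n]; inr true :: acc])
    (T + 6 * tsize b + 6 * tsize a) s'.
    apply: IHa; apply: IHb.
    by rewrite catA -rev_cat -cat_rcons -rev_cons.
  apply: exec_le (exec_loop _ _ H2) (erefl s') _; first by rewrite st_nth.
    apply: exec_case_st; rewrite /= -catA.
    by apply: exec_seq; apply: exec_push_st.
  by rewrite /=; lia.
Qed.

Lemma exec_split t s m r :
  exec (split m) (st s m [:: str t ++ r]) (6 * tsize t + 3)
    (st s m [:: r; [::]; rev (str t)]).
Proof.
have H : exec (split_loop m) (st s m [:: r; [::]; rev (str t) ++ [::]]) 1
    (st s m [:: r; [::]; rev (str t)]).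
  by rewrite cats0; apply: exec_stop; rewrite st_nth.
apply: exec_seq_le (exec_push_st _ _ _ _ _)
  (exec_src (exec_split_loop (inr true) H) _) _; last by lia.
by solve_st.
Qed.

(** * Functions computed by programs *)

(* The family of trees [v] is computed from [u] in polynomial time, on top of
   the registers below an arbitrary [m]. *)
Definition red (I : Type) (u v : I -> tree) : Prop :=
  exists2 p, ispoly p & forall m, exists c, forall i s,
    exec c (st s m [:: str (u i)]) (p (tsize (u i))) (st s m [:: str (v i)]).

Lemma exec_result_size c s m x y T :
  exec c (st s m [:: x]) T (st s m [:: y]) -> size y <= size x + T.
Proof. by move=> /exec_size /(_ (m + 0)); rewrite !st_nth. Qed.

Lemma red_size (I : Type) (u v : I -> tree) : red u v ->
  pbnd (fun i => tsize (v i)) (fun i => tsize (u i)).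
Proof.
move=> [p Pp H]; exists (fun n => n + p n).
  by apply: ispoly_add => //; exact: ispoly_id.
move=> i; have [c /(_ i (fun=> [::]))] := H 0.
by move=> /exec_result_size; rewrite !size_str.
Qed.

Lemma red_refl (I : Type) (u : I -> tree) : red u u.
Proof.
exists (fun=> 1); first exact: ispoly_const.
by move=> m; exists (Skip S) => i s; apply: exec_skip.
Qed.

Lemma red_sim (I J : Type) (u v : I -> tree) (u' v' : J -> tree) :
  red u v -> (forall j, exists i, u' j = u i /\ v' j = v i) -> red u' v'.
Proof.
move=> [p Pp H] sim; exists p => // m; have [c Hc] := H m.
by exists c => j s; have [i [-> ->]] := sim j.
Qed.

Lemma red_trans (I : Type) (v u w : I -> tree) :
  red u v -> red v w -> red u w.
Proof.
move=> [p Pp Hp] [q Pq Hq]; exists (fun n => p n + q (n + p n)).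
  do ?[apply: ispoly_add | apply: (ispoly_comp Pq)] => //; exact: ispoly_id.
move=> m; have [c Hc] := Hp m; have [d Hd] := Hq m.
exists (Seq c d) => i s; apply: exec_seq_le (Hc i s) (Hd i s) _.
rewrite leq_add2l; apply: (ispoly_mono Pq).
by have := exec_result_size (Hc i s); rewrite !size_str.
Qed.

Lemma red_node (I : Type) (u v w : I -> tree) :
  red u v -> red u w -> red u (fun i => Node (v i) (w i)).
Proof.
move=> [p Pp Hp] [q Pq Hq].
exists (fun n => (9 * p n + 9 * q n) + (39 * n + 11)).
  by do ?[apply: ispoly_add | apply: ispoly_mul | apply: ispoly_const
     | apply: ispoly_id | done].
move=> m; have [c Hc] := Hp (m + 2); have [d Hd] := Hq (m + 1).
exists (Seq (dup (m + 0) (m + 1) (m + 2)) (Seq d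
  (Seq (dup (m + 0) (m + 2) (m + 3)) (Seq c (Seq (clear (m + 0))
  (Seq (app (m + 1) (m + 0) (m + 3)) (Seq (app (m + 2) (m + 0) (m + 3))
  (Push (m + 0) (inr true))))))))) => i s.
set x := str (u i); set y := str (v i); set z := str (w i).
have ly := exec_result_size (Hc i s); have lz := exec_result_size (Hd i s).
apply: (exec_seq_le (s1 := st s m [:: x; x])).
  by apply: exec_eq (exec_dup_st _ _ _ _ _) _.
apply: (exec_seq_le (s1 := st s m [:: x; z])).
  exact: (@exec_sub m 1 d x _ z s [:: x] (erefl _) (Hd i)).
apply: (exec_seq_le (s1 := st s m [:: x; z; x])).
  by apply: exec_eq (exec_dup_st _ _ _ _ _) _.
apply: (exec_seq_le (s1 := st s m [:: x; z; y])).
  exact: (@exec_sub m 2 c x _ y s [:: x; z] (erefl _) (Hc i)).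
apply: (exec_seq_le (s1 := st s m [:: [::]; z; y])).
  exact: exec_clear_st.
apply: (exec_seq_le (s1 := st s m [:: z; [::]; y])).
  by apply: exec_eq (exec_app_st _ _ _ _) _ => //; solve_st.
apply: (exec_seq_le (s1 := st s m [:: y ++ z])).
  by apply: exec_eq (exec_app_st _ _ _ _) _ => //; solve_st.
exact: exec_push_st.
all: try exact: leqnn.
rewrite /= -/x -/y -/z in ly lz *; rewrite !size_str in ly lz *; lia.
Qed.

Lemma red_const (I : Type) (u : I -> tree) t : red u (fun=> t).
Proof.
exists (fun n => 3 * n + (2 * tsize t + 2)).
  by do ?[apply: ispoly_add | apply: ispoly_mul | apply: ispoly_const
     | apply: ispoly_id | done].
move=> m; exists (Seq (clear (m + 0))
  (foldr (fun g c => Seq c (Push (m + 0) g)) (Skip S) (str t))) => i s.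
apply: (exec_seq_le (t2 := 2 * tsize t + 1))
  (exec_clear_st s m [:: str (u i)] 0) _ _; last first.
- by rewrite /= size_str; lia.
- rewrite /= -size_str; elim: (str t) => [|g x IH] /=.
    exact: exec_weak (exec_skip _) _.
  apply: exec_seq_le IH (exec_push_st _ _ _ _ _) _; lia.
Qed.

Lemma red_fst (I : Type) (u v : I -> tree) : red (fun i => Node (u i) (v i)) u.
Proof.
exists (fun n => 17 * n + 10).
  by do ?[apply: ispoly_add | apply: ispoly_mul | apply: ispoly_const
     | apply: ispoly_id | done].
move=> m; exists (Case (m + 0) (fun=> Seq (split m) (Seq (clear (m + 0))
   (mv (m + 2) (m + 0))))) => i s.
set x := str (u i); set y := str (v i).
apply: exec_weak.
  apply: exec_case_st; apply: exec_seq (exec_split _ _ _ _) _.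
  apply: exec_seq (exec_clear_st _ _ _ _) _.
  by apply: exec_eq (exec_mv_st _ _ _ _) _ => //; solve_st.
rewrite /= size_rev !size_str; lia.
Qed.

Lemma red_snd (I : Type) (u v : I -> tree) : red (fun i => Node (u i) (v i)) v.
Proof.
exists (fun n => 17 * n + 10).
  by do ?[apply: ispoly_add | apply: ispoly_mul | apply: ispoly_const
     | apply: ispoly_id | done].
move=> m; exists (Case (m + 0) (fun=> Seq (split m) (clear (m + 2)))) => i s.
set x := str (u i); set y := str (v i).
apply: exec_weak.
  apply: exec_case_st; apply: exec_seq (exec_split _ _ _ _) _.
  by apply: exec_eq (exec_clear_st _ _ _ _) _ => //; solve_st.
rewrite /= size_rev !size_str; lia.
Qed.

Definition is_leaf t := if t is Leaf then true else false.

Lemma red_if (I : Type) (u t v : I -> tree) : red u t ->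
  red (fun i : {i | is_leaf (t i)} => u (sval i)) (fun i => v (sval i)) ->
  red (fun i : {i | ~~ is_leaf (t i)} => u (sval i)) (fun i => v (sval i)) ->
  red u v.
Proof.
move=> [p Pp Hp] [q Pq Hq] [r Pr Hr].
exists (fun n => (4 * p n + q n) + (r n + (13 * n + 4))).
  by do ?[apply: ispoly_add | apply: ispoly_mul | apply: ispoly_const
     | apply: ispoly_id | done].
move=> m; have [c Hc] := Hp (m + 1); have [d Hd] := Hq m; have [e He] := Hr m.
exists (Seq (dup (m + 0) (m + 1) (m + 2)) (Seq c (Case (m + 1) (fun o =>
  Seq (clear (m + 1)) (if o == Some (inr true) then e else d))))) => i s.
set x := str (u i); set y := str (t i); set z := str (v i).
have ly := exec_result_size (Hc i s).
rewrite -/x -/y !size_str in ly.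
apply: (exec_seq_le (s1 := st s m [:: x; x])).
  by apply: exec_eq (exec_dup_st _ _ _ _ _) _.
apply: (exec_seq_le (s1 := st s m [:: x; y])).
  exact: (@exec_sub m 1 c x _ y s [:: x] (erefl _) (Hc i)).
apply: exec_case_st.
apply: (exec_seq_le (s1 := st s m [:: x])).
  by apply: exec_eq (exec_clear_st _ _ _ _) _; solve_st.
have : exec (if ohead y == Some (inr true) then e else d) (st s m [:: x])
    (q (tsize (u i)) + r (tsize (u i))) (st s m [:: z]).
  rewrite /y; case et: (t i) => [|a b] /=.
    have hi : is_leaf (t i) by rewrite et.
    exact: exec_weak (Hd (exist _ i hi) s) (leq_addr _ _).
  have hi : ~~ is_leaf (t i) by rewrite et.
  exact: exec_weak (He (exist _ i hi) s) (leq_addl _ _).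
exact.
all: try exact: leqnn.
by rewrite /= size_behead !size_str; lia.
Qed.

Lemma red_iter (I B : Type) (n : I -> tree) (b : I -> B) (e : B -> tree)
    (f : B -> B) :
  red e (fun x => e (f x)) ->
  pbnd (fun ik : {ik : I * nat | ik.2 <= tsize (n ik.1)} =>
          tsize (e (iter (sval ik).2 f (b (sval ik).1))))
       (fun ik => tsize (n (sval ik).1) + tsize (e (b (sval ik).1))) ->
  red (fun i => Node (n i) (e (b i))) (fun i => e (iter (tsize (n i)) f (b i))).
Proof.
move=> [p Pp Hp] [q Pq Hq].
have Ppq := ispoly_comp Pp Pq.
exists (fun k => k * (p (q k) + 3) + (20 * k + (8 * q k + 20))).
  by do ?[apply: ispoly_add | apply: ispoly_mul | apply: ispoly_const
     | apply: ispoly_id | exact: Ppq | done].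
move=> m; have [c Hc] := Hp (m + 2).
pose loop := While (m + 0) (Case (m + 0) (fun=> c)).
exists (Case (m + 0) (fun=> Seq (split m) (Seq (mv (m + 0) (m + 1))
  (Seq (mv (m + 2) (m + 0)) (Seq (mv (m + 1) (m + 2))
  (Seq loop (app (m + 2) (m + 0) (m + 1)))))))) => i s.
set N := tsize (n i) + tsize (e (b i)).
have bnd k : k <= tsize (n i) -> tsize (e (iter k f (b i))) <= q N.
  by move=> kn; apply: (Hq (exist _ (i, k) kn)).
have run x k : k + size x = tsize (n i) ->
    exec loop (st s m [:: x; [::]; str (e (iter k f (b i)))])
      (size x * (p (q N) + 2) + 1)
      (st s m [:: [::]; [::]; str (e (iter (tsize (n i)) f (b i)))]).
  elim: x k => [|g x IH] k kx.
    by rewrite -kx addn0; apply: exec_stop; rewrite st_nth.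
  have kx' : k.+1 + size x = tsize (n i) by rewrite -kx /= addnS.
  apply: exec_le (exec_loop _ _ (IH _ kx')) (erefl _) _.
  - by rewrite st_nth.
  - apply: exec_case_st; apply: exec_weak.
      exact: (@exec_sub m 2 c _ _ _ s [:: x; [::]] (erefl _)
        (Hc (iter k f (b i)))).
    by apply: (ispoly_mono Pp); apply: bnd; rewrite -kx leq_addr.
  - by rewrite /= mulSn; lia.
apply: exec_weak.
  apply: exec_case_st; apply: exec_seq (exec_split _ _ _ _) _.
  apply: exec_seq (exec_mv_st _ _ _ _) _ => //.
  apply: exec_seq (exec_mv_st _ _ _ _) _ => //.
  apply: exec_seq (exec_mv_st _ _ _ _) _ => //.
  apply: exec_seq.
    apply: exec_src (run (str (n i)) 0 _) _; first by rewrite add0n size_str.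
    by solve_st.
  by apply: exec_eq (exec_app_st _ _ _ _) _ => //; solve_st.
have := bnd _ (leqnn _).
have : q N <= q (tsize (Node (n i) (e (b i)))).
  by apply: (ispoly_mono Pq); rewrite /= /N; lia.
have : p (q N) <= p (q (tsize (Node (n i) (e (b i))))).
  apply: (ispoly_mono Pp).
  by apply: (ispoly_mono Pq); rewrite /= /N; lia.
rewrite /= !cats0 !size_rev !size_str.
set X := p (q (_.+1)); set Y := q (_.+1); set Z := tsize (e _).
move: (p (q N)) (q N) => x y.
nia.
Qed.
End Trees.

(** * Codes *)

Class code (A : Type) := Code {
  enc : A -> tree;
  dec : tree -> option A;
  encK : pcancel enc dec
}.

Definition sz (A : Type) (cA : code A) (x : A) : nat := tsize (enc x).
Arguments sz {A cA} x : simpl never.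

Fixpoint spine (t : tree) : seq tree :=
  if t is Node a b then a :: spine b else [::].

#[export] Instance code_tree : code tree := @Code _ id Some (fun=> erefl).

Definition enc_unit (x : unit) := Leaf.
Lemma enc_unitK : pcancel enc_unit (fun=> Some tt).
Proof. by case. Qed.
#[export] Instance code_unit : code unit := Code enc_unitK.

Definition enc_bool (b : bool) := if b then Node Leaf Leaf else Leaf.
Lemma enc_boolK : pcancel enc_bool (fun t => Some (~~ is_leaf t)).
Proof. by case. Qed.
#[export] Instance code_bool : code bool := Code enc_boolK.

Definition enc_nat (n : nat) := iter n (Node Leaf) Leaf.
Lemma enc_natK : pcancel enc_nat (fun t => Some (size (spine t))).
Proof. by move=> n; congr Some; elim: n => //= n ->. Qed.
#[export] Instance code_nat : code nat := Code enc_natK.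

Section CodeSeq.
Context {A : Type} {cA : code A}.
Definition enc_seq (l : seq A) := foldr (fun a => Node (enc a)) Leaf l.
Definition dec_seq (t : tree) := Some (pmap dec (spine t)).
Lemma enc_seqK : pcancel enc_seq dec_seq.
Proof.
by move=> l; congr Some; elim: l => //= a l IH; rewrite encK /= IH.
Qed.
#[export] Instance code_seq : code (seq A) := Code enc_seqK.

Definition enc_option (x : option A) :=
  if x is Some a then Node Leaf (enc a) else Leaf.
Definition dec_option (t : tree) :=
  if t is Node _ a then omap Some (dec a : option A) else Some None.
Lemma enc_optionK : pcancel enc_option dec_option.
Proof. by case=> //= a; rewrite encK. Qed.
#[export] Instance code_option : code (option A) := Code enc_optionK.
End CodeSeq.

Section CodePair.
Context {A B : Type} {cA : code A} {cB : code B}.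
Definition enc_pair (x : A * B) := Node (enc x.1) (enc x.2).
Definition dec_pair (t : tree) : option (A * B) :=
  if t is Node a b then obind (fun x => omap (pair x) (dec b)) (dec a) else
    None.
Lemma enc_pairK : pcancel enc_pair dec_pair.
Proof. by case=> a b /=; rewrite !encK. Qed.
#[export] Instance code_pair : code (A * B) := Code enc_pairK.

Definition enc_sum (x : A + B) :=
  match x with
  | inl a => Node Leaf (enc a)
  | inr b => Node (Node Leaf Leaf) (enc b)
  end.
Definition dec_sum (t : tree) : option (A + B) :=
  if t is Node a b then
    if a is Leaf then omap inl (dec b) else omap inr (dec b)
  else None.
Lemma enc_sumK : pcancel enc_sum dec_sum.
Proof. by case=> a /=; rewrite encK. Qed.
#[export] Instance code_sum : code (A + B) := Code enc_sumK.
End CodePair.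

Section CodeFin.
Variable F : finType.
Definition enc_fin (x : F) := enc (enum_rank x : nat).
Definition dec_fin (t : tree) : option F :=
  nth None (map Some (enum F)) (size (spine t)).
Lemma enc_finK : pcancel enc_fin dec_fin.
Proof.
move=> x; rewrite /dec_fin /enc_fin.
have [->] := enc_natK (enum_rank x).
by rewrite (nth_map x) ?nth_enum_rank // -cardE ltn_ord.
Qed.
Definition code_fin : code F := Code enc_finK.
End CodeFin.

Lemma enc_inj {A : Type} {cA : code A} : injective (enc (A := A)).
Proof. exact: pcan_inj encK. Qed.

Lemma sz_gt0 {A : Type} {cA : code A} (x : A) : 0 < sz x.
Proof. exact: tsize_gt0. Qed.

Section Sizes.
Context {A B : Type} {cA : code A} {cB : code B}.

Lemma sz_cons (a : A) l : sz (a :: l) = (sz a + sz l).+1.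
Proof. by []. Qed.

Lemma sz_pair (a : A) (b : B) : sz (a, b) = (sz a + sz b).+1.
Proof. by []. Qed.

Lemma sz_cat (l l' : seq A) : sz (l ++ l') = (sz l + sz l').-1.
Proof.
elim: l => [|a l IH] //.
have l0 : 0 < sz l by exact: sz_gt0.
by rewrite cat_cons !sz_cons IH; lia.
Qed.

Lemma sz_take k (l : seq A) : sz (take k l) <= sz l.
Proof.
rewrite -{2}(cat_take_drop k l) sz_cat.
have : 0 < sz (drop k l) by exact: sz_gt0.
lia.
Qed.

Lemma sz_drop k (l : seq A) : sz (drop k l) <= sz l.
Proof.
rewrite -{2}(cat_take_drop k l) sz_cat.
have : 0 < sz (take k l) by exact: sz_gt0.
lia.
Qed.

Lemma size_le_sz (l : seq A) : size l < sz l.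
Proof. by elim: l => [|a l] //=; rewrite sz_cons; lia. Qed.
End Sizes.

Lemma sz_nat (n : nat) : sz n = n.*2.+1.
Proof.
elim: n => // n IH.
by rewrite [LHS](_ : _ = (1 + sz n).+1) // IH; lia.
Qed.

Lemma sz_bool (b : bool) : sz b <= 3.
Proof. by case: b. Qed.

(** * Polynomial-time functions *)

(* The program may do anything on the trees that are not codes. *)
Definition PT (A B : Type) (cA : code A) (cB : code B) (f : A -> B) : Prop :=
  red sym (fun x => enc x) (fun x => enc (f x)).
Arguments PT {A B cA cB} f.

Lemma red_case (I : Type) (u t v : I -> tree) : red sym u t ->
  red sym (fun i : {i | is_leaf (t i)} => u (sval i)) (fun i => v (sval i)) ->
  red sym (fun i : {i | ~~ is_leaf (t i)} => Node (u (sval i)) (t (sval i)))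
    (fun i => v (sval i)) ->
  red sym u v.
Proof.
move=> ut H1 H2; apply: (red_if ut) => //.
apply: red_trans H2; apply: red_node; first exact: red_refl.
by apply: red_sim ut _ => i; exists (sval i).
Qed.

Section Basic.
Context {E A B : Type} {cE : code E} {cA : code A} {cB : code B}.

Lemma PT_pbnd (f : A -> B) : PT f -> pbnd (fun x => sz (f x)) sz.
Proof. exact: red_size. Qed.

Lemma PT_ext (f g : A -> B) : PT f -> f =1 g -> PT g.
Proof. by move=> H e; apply: red_sim H _ => x; exists x; rewrite e. Qed.

Lemma PT_id : PT (fun x : A => x).
Proof. exact: red_refl. Qed.

Lemma PT_comp (f : A -> B) (g : E -> A) : PT f -> PT g -> PT (fun x => f (g x)).
Proof.
move=> Hf Hg; apply: red_trans Hg _.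
by apply: red_sim Hf _ => x; exists (g x).
Qed.

Lemma PT_const (b : B) : PT (fun _ : E => b).
Proof. exact: red_const. Qed.

Lemma PT_pair (f : E -> A) (g : E -> B) : PT f -> PT g ->
  PT (fun x => (f x, g x)).
Proof. exact: red_node. Qed.

Lemma PT_fst (f : E -> A * B) : PT f -> PT (fun x => (f x).1).
Proof. by move=> H; apply: red_trans H _; apply: red_fst. Qed.

Lemma PT_snd (f : E -> A * B) : PT f -> PT (fun x => (f x).2).
Proof. by move=> H; apply: red_trans H _; apply: red_snd. Qed.

Lemma PT_cons (f : E -> A) (g : E -> seq A) :
  PT f -> PT g -> PT (fun x => f x :: g x).
Proof. exact: red_node. Qed.

Lemma PT_some (f : E -> A) : PT f -> PT (fun x => Some (f x)).
Proof. by move=> H; apply: red_node H; apply: red_const. Qed.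

Lemma PT_inl (f : E -> A) : PT f -> PT (fun x => inl (f x) : A + B).
Proof. by move=> H; apply: red_node H; apply: red_const. Qed.

Lemma PT_inr (f : E -> B) : PT f -> PT (fun x => inr (f x) : A + B).
Proof. by move=> H; apply: red_node H; apply: red_const. Qed.

Lemma PT_succ (f : E -> nat) : PT f -> PT (fun x => (f x).+1).
Proof. by move=> H; apply: red_node H; apply: red_const. Qed.

Lemma PT_node (f g : E -> tree) : PT f -> PT g ->
  PT (fun x => Node (f x) (g x)).
Proof. exact: red_node. Qed.
End Basic.

Lemma red_right : red sym (fun i : {t | ~~ is_leaf t} => sval i)
  (fun i => if sval i is Node _ b then b else Leaf).
Proof.
apply: (red_sim (@red_snd sym (tree * tree) fst snd)).
by case=> -[|a b] //= _; exists (a, b).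
Qed.

Section Cases.
Context {E A A' B : Type} {cE : code E} {cA : code A} {cA' : code A'}
  {cB : code B}.

Lemma PT_case_tree (t : E -> tree) (f : E -> B) (g : E * (tree * tree) -> B) :
  PT t -> PT f -> PT g ->
  PT (fun e => if t e is Node a b then g (e, (a, b)) else f e).
Proof.
move=> Ht Hf Hg; apply: (red_case Ht).
  by apply: red_sim Hf _ => -[e i] /=; exists e; case: (t e) i.
apply: red_sim Hg _ => -[e] /=; case et: (t e) => [|a b] //= _.
by exists (e, (a, b)).
Qed.

Lemma PT_case_seq (l : E -> seq A) (f : E -> B) (g : E * (A * seq A) -> B) :
  PT l -> PT f -> PT g ->
  PT (fun e => if l e is a :: l' then g (e, (a, l')) else f e).
Proof.
move=> Ht Hf Hg; apply: (red_case Ht).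
  by apply: red_sim Hf _ => -[e i] /=; exists e; case: (l e) i.
apply: red_sim Hg _ => -[e] /=; case et: (l e) => [|a b] //= _.
by exists (e, (a, b)).
Qed.

Lemma PT_case_option (t : E -> option A) (f : E -> B) (g : E * A -> B) :
  PT t -> PT f -> PT g ->
  PT (fun e => if t e is Some a then g (e, a) else f e).
Proof.
move=> Ht Hf Hg; apply: (red_case Ht).
  by apply: red_sim Hf _ => -[e i] /=; exists e; case: (t e) i.
apply: (red_trans (v := fun i => Node (enc (sval i))
   (if enc (t (sval i)) is Node _ a then a else Leaf))).
  apply: red_node; first exact: red_fst.
  apply: red_trans (red_snd _ _ _) _.
  apply: red_sim red_right _ => -[e i].
  by exists (exist _ (enc (t e)) i).
apply: red_sim Hg _ => -[e] /=; case et: (t e) => [a|] //= _.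
by exists (e, a).
Qed.

Lemma PT_case_nat (n : E -> nat) (f : E -> B) (g : E * nat -> B) :
  PT n -> PT f -> PT g ->
  PT (fun e => if n e is k.+1 then g (e, k) else f e).
Proof.
move=> Ht Hf Hg; apply: (red_case Ht).
  by apply: red_sim Hf _ => -[e i] /=; exists e; case: (n e) i.
apply: (red_trans (v := fun i => Node (enc (sval i)) (enc (n (sval i)).-1))).
  apply: red_node; first exact: red_fst.
  apply: red_trans (red_snd _ _ _) _.
  apply: red_sim red_right _ => -[e i].
  by exists (exist _ (enc (n e)) i) => /=; case: (n e) i.
apply: red_sim Hg _ => -[e] /=; case et: (n e) => [|a] //= _.
by exists (e, a).
Qed.

Lemma PT_if (b : E -> bool) (f g : E -> B) :
  PT b -> PT f -> PT g -> PT (fun e => if b e then f e else g e).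
Proof.
move=> Ht Hf Hg; apply: (red_if Ht).
  by apply: red_sim Hg _ => -[e i] /=; exists e; case: (b e) i.
by apply: red_sim Hf _ => -[e i] /=; exists e; case: (b e) i.
Qed.

Lemma PT_case_sum (t : E -> A + A') (f : E * A -> B) (g : E * A' -> B) :
  PT t -> PT f -> PT g ->
  PT (fun e => match t e with inl a => f (e, a) | inr b => g (e, b) end).
Proof.
move=> Ht Hf Hg.
pose tag e := if t e is inl _ then Leaf else Node Leaf Leaf.
pose val e := match t e with inl a => @enc _ cA a | inr a => @enc _ cA' a end.
have Ht' : red sym (fun e : E => enc e) (fun e => Node (tag e) (val e)).
  by apply: red_sim Ht _ => e; exists e; rewrite /tag /val; case: (t e).
have Htag := red_trans Ht' (red_fst _ _ _).
have Hval : red sym (fun e : E => enc e) (fun e => Node (enc e) (val e)).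
  by apply: red_node (red_refl _ _) (red_trans Ht' (red_snd _ _ _)).
apply: (red_if Htag).
  apply: (red_trans (v := fun i => Node (enc (sval i)) (val (sval i)))).
    by apply: red_sim Hval _ => i; exists (sval i).
  apply: red_sim Hf _ => -[e] /=; rewrite /tag /val.
  by case: (t e) => [a|a] //= _; exists (e, a).
apply: (red_trans (v := fun i => Node (enc (sval i)) (val (sval i)))).
  by apply: red_sim Hval _ => i; exists (sval i).
apply: red_sim Hg _ => -[e] /=; rewrite /tag /val.
by case: (t e) => [a|a] //= _; exists (e, a).
Qed.
End Cases.

(** * Iteration *)

Ltac pt_proj := repeat first [exact: PT_id | assumption | apply: PT_fst
  | apply: PT_snd | apply: PT_pair].

Section Iteration.
Context {E A B : Type} {cE : code E} {cA : code A} {cB : code B}.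

Definition fold_step (f : E * (A * B) -> B) (s : E * (seq A * B)) :=
  if s.2.1 is a :: l then (s.1, (l, f (s.1, (a, s.2.2)))) else s.

Lemma fold_step_iter f e l b k :
  iter k (fold_step f) (e, (l, b)) =
  (e, (drop k l, foldl (fun z a => f (e, (a, z))) b (take k l))).
Proof.
elim: k l b => [|k IH] l b; first by rewrite take0 drop0.
rewrite iterSr /fold_step; case: l => [|a l] /=; last exact: IH.
rewrite -/(fold_step f).
by elim: k {IH} => //= k ->.
Qed.

Lemma PT_foldl (l : E -> seq A) (b : E -> B) (f : E * (A * B) -> B) :
  PT l -> PT b -> PT f ->
  pbnd (fun x : E * nat => sz (foldl (fun z a => f (x.1, (a, z))) (b x.1)
                                     (take x.2 (l x.1))))
       (fun x => sz x.1) ->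
  PT (fun e => foldl (fun z a => f (e, (a, z))) (b e) (l e)).
Proof.
move=> Hl Hb Hf bnd.
have Hs : PT (fold_step f).
  apply: (PT_case_seq (l := fun s : E * (seq A * B) => s.2.1)
    (f := fun s => s) (g := fun x =>
      (x.1.1, (x.2.2, f (x.1.1, (x.2.1, x.1.2.2)))))); try by pt_proj.
  by do 2!(apply: PT_pair; first by pt_proj); apply: PT_comp Hf _; pt_proj.
have Hn : PT (fun e => (l e, (e, (l e, b e)))).
  by do 2?[apply: PT_pair => //]; [exact: PT_id | exact: PT_pair].
apply: PT_ext
  (PT_snd (PT_snd
    (_ : PT (fun e => iter (sz (l e)) (fold_step f) (e, (l e, b e)))))) _.
  apply: (red_trans Hn).
  apply: (red_iter (n := fun e => enc (l e)) (b := fun e => (e, (l e, b e)))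
    Hs).
  have bnd' :=
    pbnd_reindex (fun ik : {ik : E * nat | ik.2 <= tsize (enc (l ik.1))} =>
      sval ik) bnd.
  apply: (@pbnd_le _ _ (fun ik => (sz (sval ik).1 + sz (l (sval ik).1)
    + sz (foldl (fun z a => f ((sval ik).1, (a, z))) (b (sval ik).1)
                                     (take (sval ik).2 (l (sval ik).1)))).+2)).
    move=> [[e k] /= _]; rewrite fold_step_iter; set F := foldl _ _ _.
    change (is_true ((sz e + (sz (drop k (l e)) + sz F).+1).+1 <=
      (sz e + sz (l e) + sz F).+2)).
    have : sz (drop k (l e)) <= sz (l e) by exact: sz_drop.
    lia.
  apply: (@pbnd_trans _ _ (fun ik => sz (sval ik).1)); last first.
    apply: pbnd_id_le => -[[e k] /= _].
    change (is_true (sz e <= sz (l e) + (sz e + sz (l e, b e)).+1)); lia.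
  apply: (@pbnd_le _ _ (fun ik => (sz (sval ik).1 + sz (l (sval ik).1)
    + sz (foldl (fun z a => f ((sval ik).1, (a, z))) (b (sval ik).1)
                 (take (sval ik).2 (l (sval ik).1)))) + 2)) => [ik|].
    by rewrite addn2.
  apply: pbnd_add; last exact: pbnd_const.
  apply: pbnd_add => //; apply: pbnd_add; first exact: pbnd_refl.
  exact: (pbnd_reindex (fun ik :
    {ik : E * nat | ik.2 <= tsize (enc (l ik.1))} => (sval ik).1) (PT_pbnd Hl)).
move=> e; rewrite fold_step_iter /= take_oversize //.
exact: ltnW (size_le_sz _).
Qed.

Lemma foldl_size (f : E * (A * B) -> B) (p : nat -> nat) e M :
  ispoly p ->
  (forall a z, sz (f (e, (a, z))) <= sz z + p (sz e + sz a)) ->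
  forall l b, sz l <= M ->
  sz (foldl (fun z a => f (e, (a, z))) b l) <= sz b + size l * p (sz e + M).
Proof.
move=> Pp H; elim=> [|a l IH] b lM; first by rewrite addn0.
rewrite sz_cons in lM; apply: leq_trans (IH _ _) _; first by lia.
have : p (sz e + sz a) <= p (sz e + M) by apply: (ispoly_mono Pp); lia.
have /= := H a b; rewrite mulSn; lia.
Qed.

Lemma PT_foldl_add (l : E -> seq A) (b : E -> B) (f : E * (A * B) -> B)
    (g : E * A -> nat) :
  PT l -> PT b -> PT f -> pbnd g sz ->
  (forall e a z, sz (f (e, (a, z))) <= sz z + g (e, a)) ->
  PT (fun e => foldl (fun z a => f (e, (a, z))) (b e) (l e)).
Proof.
move=> Hl Hb Hf [p Pp Hp] Hg; apply: PT_foldl => //.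
pose q n := p n.+1.
have Pq : ispoly q.
  rewrite (_ : q = fun n => p (n + 1)); last first.
    by apply: functional_extensionality => n; rewrite addn1.
  apply: ispoly_comp => //; apply: ispoly_add; first exact: ispoly_id.
  exact: ispoly_const.
apply: (@pbnd_le _ _ (fun x : E * nat => sz (b x.1) + sz (l x.1) * q (sz x.1 +
  sz (l x.1)))).
  move=> [e k] /=.
  apply: leq_trans (foldl_size Pq _ (b e) (sz_take k (l e))) _.
    move=> a z; apply: leq_trans (Hg _ _ _) _; rewrite leq_add2l.
    by apply: leq_trans (Hp _) _.
  rewrite leq_add2l leq_mul2r; apply/orP; right.
  by apply: leq_trans (sz_take k _); apply: ltnW (size_le_sz _).
apply: pbnd_add; last apply: pbnd_mul; last apply: pbnd_comp => //.
- exact: (pbnd_reindex (fun x : E * nat => x.1) (PT_pbnd Hb)).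
- exact: (pbnd_reindex (fun x : E * nat => x.1) (PT_pbnd Hl)).
apply: pbnd_add; first exact: pbnd_refl.
exact: (pbnd_reindex (fun x : E * nat => x.1) (PT_pbnd Hl)).
Qed.
End Iteration.

Ltac pbnd_arith := repeat first [exact: pbnd_const | exact: pbnd_refl |
  apply: pbnd_add
  | apply: pbnd_mul | assumption].

Section Lists.
Context {E A B : Type} {cE : code E} {cA : code A} {cB : code B}.

Lemma PT_rev (l : E -> seq A) : PT l -> PT (fun e => rev (l e)).
Proof.
move=> Hl.
apply: PT_ext (PT_foldl_add (f := fun x : E * (A * seq A) => x.2.1 :: x.2.2)
  (g := fun x : E * A => sz x + 1) Hl (PT_const [::]) _ _ _) _.
- by apply: PT_cons; [apply: PT_fst | apply: PT_snd]; apply: PT_snd PT_id.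
- pbnd_arith.
- by move=> e a z; rewrite /= sz_cons sz_pair; lia.
- by move=> e; rewrite /rev; elim: (l e) [::] => //= a l' IH z.
Qed.
End Lists.

Section Lists2.
Context {E A B : Type} {cE : code E} {cA : code A} {cB : code B}.

Lemma PT_foldr_add (l : E -> seq A) (b : E -> B) (f : E * (A * B) -> B)
    (g : E * A -> nat) :
  PT l -> PT b -> PT f -> pbnd g sz ->
  (forall e a z, sz (f (e, (a, z))) <= sz z + g (e, a)) ->
  PT (fun e => foldr (fun a z => f (e, (a, z))) (b e) (l e)).
Proof.
move=> Hl Hb Hf Hg H.
apply: PT_ext (PT_foldl_add (PT_rev Hl) Hb Hf Hg H) _ => e.
by rewrite foldl_rev.
Qed.

Lemma PT_foldr_bnd (l : E -> seq A) (b : E -> B) (f : E * (A * B) -> B) c :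
  PT l -> PT b -> PT f -> (forall x, sz (f x) <= c) ->
  PT (fun e => foldr (fun a z => f (e, (a, z))) (b e) (l e)).
Proof.
move=> Hl Hb Hf Hc; apply: (PT_foldr_add (g := fun=> c)) => //;
  first by pbnd_arith.
by move=> e a z; apply: leq_trans (Hc _) (leq_addl _ _).
Qed.

End Lists2.

Section Lists3.
Context {E A B : Type} {cE : code E} {cA : code A} {cB : code B}.

Lemma PT_map (l : E -> seq A) (h : E * A -> B) :
  PT l -> PT h -> PT (fun e => [seq h (e, a) | a <- l e]).
Proof.
move=> Hl Hh.
apply: PT_ext (PT_foldr_add (f := fun x : E * (A * seq B) => h (x.1, x.2.1) ::
  x.2.2)
  (g := fun x : E * A => sz (h x) + 1) Hl (PT_const [::]) _ _ _) _.
- apply: PT_cons; last exact: PT_snd (PT_snd PT_id).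
  apply: PT_comp Hh _; apply: PT_pair; first exact: PT_fst PT_id.
  exact: PT_fst (PT_snd PT_id).
- by pbnd_arith; apply: PT_pbnd.
- by move=> e a z; rewrite /= sz_cons; lia.
- by move=> e /=; elim: (l e) => //= a l' ->.
Qed.

Lemma PT_pmap (l : E -> seq A) (h : E * A -> option B) :
  PT l -> PT h -> PT (fun e => pmap (fun a => h (e, a)) (l e)).
Proof.
move=> Hl Hh.
apply: PT_ext (PT_foldr_add (f := fun x : E * (A * seq B) => if h (x.1, x.2.1)
  is Some y then (x, y).2 :: (x, y).1.2.2 else x.2.2)
  (g := fun x : E * A => sz (h x) + 1) Hl (PT_const [::]) _ _ _) _.
- apply: (PT_case_option (g := fun xy => xy.2 :: xy.1.2.2)).
  + apply: PT_comp Hh _; apply: PT_pair; first exact: PT_fst PT_id.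
    exact: PT_fst (PT_snd PT_id).
  + exact: PT_snd (PT_snd PT_id).
  + apply: PT_cons; first exact: PT_snd PT_id.
    exact: PT_snd (PT_snd (PT_fst PT_id)).
- by pbnd_arith; apply: PT_pbnd.
- move=> e a z /=; case: (h _) => [y|]; last by lia.
  by rewrite sz_cons [X in _ <= _ + (X + _)](_ : _ = (1 + sz y).+1) //; lia.
- by move=> e /=; elim: (l e) => //= a l' ->; case: (h _).
Qed.

Lemma PT_filter (l : E -> seq A) (h : E * A -> bool) :
  PT l -> PT h -> PT (fun e => [seq a <- l e | h (e, a)]).
Proof.
move=> Hl Hh.
apply: PT_ext (PT_foldr_add (f := fun x : E * (A * seq A) => if h (x.1, x.2.1)
  then x.2.1 :: x.2.2 else x.2.2)
  (g := fun x : E * A => sz x + 1) Hl (PT_const [::]) _ _ _) _.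
- apply: PT_if; last exact: PT_snd (PT_snd PT_id).
    apply: PT_comp Hh _; apply: PT_pair; first exact: PT_fst PT_id.
    exact: PT_fst (PT_snd PT_id).
  apply: PT_cons; last exact: PT_snd (PT_snd PT_id).
  exact: PT_fst (PT_snd PT_id).
- by pbnd_arith.
- by move=> e a z /=; rewrite sz_pair; case: (h _) => //; rewrite ?sz_cons; lia.
- by move=> e /=; elim: (l e) => //= a l' ->.
Qed.

Lemma PT_all (l : E -> seq A) (h : E * A -> bool) :
  PT l -> PT h -> PT (fun e => all (fun a => h (e, a)) (l e)).
Proof.
move=> Hl Hh.
apply: PT_ext (PT_foldr_bnd (f := fun x : E * (A * bool) => if h (x.1, x.2.1)
  then x.2.2 else false)
  (c := 3) Hl (PT_const true) _ _) _.
- apply: PT_if; last exact: PT_const.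
    apply: PT_comp Hh _; apply: PT_pair; first exact: PT_fst PT_id.
    exact: PT_fst (PT_snd PT_id).
  exact: PT_snd (PT_snd PT_id).
- by move=> x; apply: sz_bool.
- by move=> e /=; elim: (l e) => //= a l' ->.
Qed.

Lemma PT_has (l : E -> seq A) (h : E * A -> bool) :
  PT l -> PT h -> PT (fun e => has (fun a => h (e, a)) (l e)).
Proof.
move=> Hl Hh.
apply: PT_ext (PT_foldr_bnd (f := fun x : E * (A * bool) => if h (x.1, x.2.1)
  then true else x.2.2)
  (c := 3) Hl (PT_const false) _ _) _.
- apply: PT_if; last exact: PT_snd (PT_snd PT_id); last exact: PT_const.
  apply: PT_comp Hh _; apply: PT_pair; first exact: PT_fst PT_id.
  exact: PT_fst (PT_snd PT_id).
- by move=> x; apply: sz_bool.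
- by move=> e /=; elim: (l e) => //= a l' ->.
Qed.

Lemma PT_cat (f g : E -> seq A) : PT f -> PT g -> PT (fun e => f e ++ g e).
Proof.
move=> Hf Hg.
apply: PT_ext (PT_foldr_add (f := fun x : E * (A * seq A) => x.2.1 :: x.2.2)
  (g := fun x : E * A => sz x + 1) Hf Hg _ _ _) _.
- by apply: PT_cons; [apply: PT_fst | apply: PT_snd]; apply: PT_snd PT_id.
- pbnd_arith.
- by move=> e a z; rewrite /= sz_cons sz_pair; lia.
- by move=> e; elim: (f e) => //= a l ->.
Qed.
End Lists3.

Section Lists4.
Context {E A B : Type} {cE : code E} {cA : code A} {cB : code B}.

Lemma PT_flatten (l : E -> seq (seq A)) : PT l -> PT (fun e => flatten (l e)).
Proof.
move=> Hl.
apply: PT_ext (PT_foldr_add (f := fun x : E * (seq A * seq A) => x.2.1 ++ x.2.2)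
  (g := fun x : E * (seq A) => sz x) Hl (PT_const [::]) _ _ _) _.
- by apply: PT_cat; [apply: PT_fst | apply: PT_snd]; apply: PT_snd PT_id.
- pbnd_arith.
- by move=> e a z; rewrite sz_cat sz_pair /=; lia.
- by move=> e; elim: (l e) => //= a l' ->.
Qed.

Lemma PT_behead (l : E -> seq A) : PT l -> PT (fun e => behead (l e)).
Proof.
move=> Hl.
apply: PT_ext (PT_case_seq Hl (PT_const [::]) (PT_snd (PT_snd PT_id))) _ =>
  e /=.
by case: (l e).
Qed.

Lemma PT_head (a0 : A) (l : E -> seq A) : PT l -> PT (fun e => head a0 (l e)).
Proof.
move=> Hl.
apply: PT_ext (PT_case_seq Hl (PT_const a0) (PT_fst (PT_snd PT_id))) _ => e /=.
by case: (l e).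
Qed.

Lemma PT_nth (a0 : A) (l : E -> seq A) i : PT l -> PT (fun e => nth a0 (l e) i).
Proof.
elim: i l => [|i IH] l Hl; first by apply: PT_ext (PT_head a0 Hl) _ => e; case:
  (l e).
apply: PT_ext (IH _ (PT_behead Hl)) _ => e; by rewrite nth_behead.
Qed.

Lemma PT_size (l : E -> seq A) : PT l -> PT (fun e => size (l e)).
Proof.
move=> Hl.
apply: PT_ext (PT_foldr_add (f := fun x : E * (A * nat) => x.2.2.+1)
  (g := fun=> 2) Hl (PT_const 0) _ _ _) _.
- exact: PT_succ (PT_snd (PT_snd PT_id)).
- pbnd_arith.
- by move=> e a z; rewrite !sz_nat /=; lia.
- by move=> e; elim: (l e) => //= a l' ->.
Qed.

Lemma PT_nseq_tt (n : E -> nat) : PT n -> PT (fun e => nseq (n e) tt).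
Proof.
move=> Hn; apply: red_sim Hn _ => e; exists e; split=> //.
by elim: (n e) => //= k ->.
Qed.

Lemma PT_iter (n : E -> nat) (b : E -> B) (f : E * B -> B) :
  PT n -> PT b -> PT f ->
  pbnd (fun x : E * nat => sz (iter x.2 (fun z => f (x.1, z)) (b x.1)))
       (fun x => sz x.1 + x.2) ->
  PT (fun e => iter (n e) (fun z => f (e, z)) (b e)).
Proof.
move=> Hn Hb Hf bnd.
have it e z k : foldl (fun z (a : unit) => f (e, z)) z (nseq k tt) =
  iter k (fun z => f (e, z)) z.
  by elim: k z => // k IH z; rewrite iterSr -IH.
apply: PT_ext (PT_foldl (f := fun x : E * (unit * B) => f (x.1, x.2.2))
  (PT_nseq_tt Hn) Hb _ _) _.
- by apply: PT_comp Hf _; pt_proj.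
- have := pbnd_reindex (fun x : E * nat => (x.1, minn x.2 (n x.1))) bnd => bnd'.
  apply: (@pbnd_trans _ _ (fun x => sz x.1 + minn x.2 (n x.1))).
    apply: pbnd_le bnd' => -[e k] /=.
    rewrite -it; case: (leqP k (n e)) => [kn|nk]; first by rewrite take_nseq.
    by rewrite take_oversize // size_nseq ltnW.
  apply: pbnd_add; first exact: pbnd_refl.
  apply: (@pbnd_le _ _ (fun x => sz (n x.1))).
    by move=> [e k] /=; rewrite sz_nat; lia.
  exact: (pbnd_reindex (fun x : E * nat => x.1) (PT_pbnd Hn)).
- by move=> e; rewrite /= it.
Qed.

End Lists4.

Section IterAdd.
Context {E B : Type} {cE : code E} {cB : code B}.

Lemma PT_iter_add (n : E -> nat) (b : E -> B) (f : E * B -> B) (g : E -> nat) :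
  PT n -> PT b -> PT f -> pbnd g sz ->
  (forall e z, sz (f (e, z)) <= sz z + g e) ->
  PT (fun e => iter (n e) (fun z => f (e, z)) (b e)).
Proof.
move=> Hn Hb Hf bnd H; apply: PT_iter => //.
have p1 := pbnd_reindex (fun x : E * nat => x.1) bnd.
have p2 := pbnd_reindex (fun x : E * nat => x.1) (PT_pbnd Hb).
have p3 : pbnd (fun x : E * nat => sz x.1) (fun x => sz x.1 + x.2).
  by apply: pbnd_id_le => x; apply: leq_addr.
apply: (@pbnd_le _ _ (fun x : E * nat => sz (b x.1) + x.2 * g x.1)).
  move=> [e k] /=; elim: k => [|k IH] /=; first by rewrite addn0.
  by have := H e (iter k (fun z => f (e, z)) (b e)); rewrite mulSn; lia.
apply: pbnd_add; last apply: pbnd_mul.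
- exact: pbnd_trans p2 p3.
- by apply: pbnd_id_le => x; apply: leq_addl.
- exact: pbnd_trans p1 p3.
Qed.

End IterAdd.

Lemma PT_addn {E : Type} {cE : code E} (m n : E -> nat) : PT m -> PT n ->
  PT (fun e => m e + n e).
Proof.
move=> Hm Hn.
apply: PT_ext (PT_iter_add (f := fun x => x.2.+1) (g := fun=> 2) Hm Hn _ _ _) _.
- exact: PT_succ (PT_snd PT_id).
- pbnd_arith.
- by move=> e z; rewrite !sz_nat /=; lia.
- by move=> e /=; rewrite iter_succn addnC.
Qed.

Lemma PT_predn {E : Type} {cE : code E} (n : E -> nat) : PT n ->
  PT (fun e => (n e).-1).
Proof.
move=> Hn; apply: PT_ext (PT_case_nat Hn (PT_const 0) (PT_snd PT_id)) _ => e /=.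
by case: (n e).
Qed.

Lemma PT_subn {E : Type} {cE : code E} (m n : E -> nat) : PT m -> PT n ->
  PT (fun e => m e - n e).
Proof.
move=> Hm Hn.
apply: PT_ext (PT_iter_add (f := fun x => x.2.-1) (g := fun=> 0) Hn Hm _ _ _) _.
- exact: PT_predn (PT_snd PT_id).
- pbnd_arith.
- by move=> e z; rewrite !sz_nat /=; lia.
- by move=> e /=; rewrite iter_predn.
Qed.

Lemma PT_eq0 {E : Type} {cE : code E} (n : E -> nat) : PT n ->
  PT (fun e => n e == 0).
Proof.
move=> Hn.
apply: PT_ext (PT_case_nat Hn (PT_const true) (PT_const false)) _ => e /=.
by case: (n e).
Qed.

Lemma PT_leq {E : Type} {cE : code E} (m n : E -> nat) : PT m -> PT n ->
  PT (fun e => m e <= n e).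
Proof. by move=> Hm Hn; apply: PT_ext (PT_eq0 (PT_subn Hm Hn)) _. Qed.

Lemma PT_and {E : Type} {cE : code E} (a b : E -> bool) : PT a -> PT b ->
  PT (fun e => a e && b e).
Proof.
by move=> Ha Hb; apply: PT_ext (PT_if Ha Hb (PT_const false)) _ => e; case:
  (a e).
Qed.

Lemma PT_neg {E : Type} {cE : code E} (a : E -> bool) : PT a ->
  PT (fun e => ~~ a e).
Proof.
move=> Ha.
by apply: PT_ext (PT_if Ha (PT_const false) (PT_const true)) _ => e; case:
  (a e).
Qed.
Lemma PT_muln {E : Type} {cE : code E} (m n : E -> nat) : PT m -> PT n ->
  PT (fun e => m e * n e).
Proof.
move=> Hm Hn.
apply: PT_ext (PT_iter_add (f := fun x => n x.1 + x.2) (g := fun e => sz (n e))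
  Hm (PT_const 0) _ _ _) _.
- by apply: PT_addn (PT_comp Hn (PT_fst PT_id)) (PT_snd PT_id).
- exact: PT_pbnd.
- by move=> e z; rewrite !sz_nat /=; lia.
- by move=> e /=; rewrite iter_addn_0 mulnC.
Qed.

Lemma PT_expn {E : Type} {cE : code E} (d : nat) (n : E -> nat) : PT n ->
  PT (fun e => n e ^ d).
Proof.
move=> Hn; elim: d => [|d IH]; first exact: PT_const.
by apply: PT_ext (PT_muln Hn IH) _ => e; rewrite expnS.
Qed.

Lemma PT_uphalf {E : Type} {cE : code E} (n : E -> nat) : PT n ->
  PT (fun e => uphalf (n e)).
Proof.
move=> Hn; pose f (x : E * (bool * nat)) :=
  (~~ x.2.1, if x.2.1 then x.2.2 else x.2.2.+1).
have Hf : PT f.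
  apply: PT_pair; first exact: PT_neg (PT_fst (PT_snd PT_id)).
  apply: PT_if; first exact: PT_fst (PT_snd PT_id).
    exact: PT_snd (PT_snd PT_id).
  exact: PT_succ (PT_snd (PT_snd PT_id)).
apply: PT_ext
  (PT_snd (PT_iter_add (f := f) (g := fun=> 5) Hn (PT_const (false, 0)) Hf _ _))
    _.
- pbnd_arith.
- move=> e [b k]; rewrite /f /= !sz_pair.
  by have := sz_bool (~~ b); case: b => ?; rewrite ?sz_nat; lia.
move=> e; have -> : iter (n e) (fun z => f (e, z)) (false, 0) =
  (odd (n e), uphalf (n e)) => //.
by elim: (n e) => //= k ->; rewrite /f /= uphalf_half; case: (odd k) => //=;
  rewrite ?add0n ?add1n.
Qed.

(** * Finite alphabets *)

Lemma PT_nat_table {B : Type} {cB : code B} N {E : Type} {cE : code E}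
    (n : E -> nat) (f : nat -> E -> B) :
  PT n -> (forall k, k <= N -> PT (f k)) -> PT (fun e => f (minn N (n e)) e).
Proof.
elim: N E cE n f => [|N IH] E cE n f Hn Hf.
  by apply: PT_ext (Hf 0 (leqnn 0)) _ => e; rewrite min0n.
have H : PT (fun x : E * nat => f (minn N x.2).+1 x.1).
  apply: (IH _ _ (fun x : E * nat => x.2) (fun k x => f k.+1 x.1));
    first by pt_proj.
  by move=> k kN; apply: PT_comp (Hf _ _) _ => //; pt_proj.
apply: PT_ext (PT_case_nat Hn (Hf 0 (leq0n _)) H) _.
by move=> e /=; case: (n e) => [|k]; rewrite ?minn0 // minnSS.
Qed.

Lemma PT_fin {E B : Type} {cE : code E} {cB : code B} (F : finType)
    (cF := code_fin F) (x : E -> F) (f : F -> E -> B) :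
  PT x -> (forall a, PT (f a)) -> PT (fun e => f (x e) e).
Proof.
move=> Hx Hf; have Hn : PT (fun e => enum_rank (x e) : nat) by exact: Hx.
case: (pickP (fun _ : F => true)) => [a0 _|F0]; last first.
  by apply: red_sim (@red_refl sym tree id) _ => e; have := F0 (x e).
apply: PT_ext (PT_nat_table (N := #|F|)
  (f := fun k e => f (nth a0 (enum F) k) e) Hn _) _ => // e.
by rewrite (minn_idPr _) ?nth_enum_rank // ltnW.
Qed.

Lemma PT_fin_seq {B : Type} {cB : code B} (F : finType) (cF := code_fin F)
    k {E : Type} {cE : code E} (l : E -> seq F) (f : seq F -> E -> B) :
  PT l -> (forall w, PT (f w)) -> PT (fun e => f (take k (l e)) e).
Proof.
elim: k E cE l f => [|k IH] E cE l f Hl Hf.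
  by apply: PT_ext (Hf [::]) _ => e; rewrite take0.
pose g (x : E * (F * seq F)) := f (x.2.1 :: take k x.2.2) x.1.
have Hg : PT g.
  apply: (PT_fin (x := fun x : E * (F * seq F) => x.2.1)
    (f := fun a x => f (a :: take k x.2.2) x.1)); first by pt_proj.
  move=> a; apply: (IH _ _ (fun x : E * (F * seq F) => x.2.2)
    (fun w x => f (a :: w) x.1)); first by pt_proj.
  by move=> w; apply: PT_comp (Hf _) _; pt_proj.
apply: PT_ext (PT_case_seq Hl (Hf [::]) Hg) _ => e.
by rewrite /g; case: (l e).
Qed.

Lemma sz_fin (F : finType) (cF := code_fin F) (a : F) : sz a <= #|F|.*2.
Proof.
rewrite [leqLHS](_ : _ = sz (enum_rank a : nat)) // sz_nat.
by rewrite ltn_double.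
Qed.

(** * Equality, parsing and decoding *)

Lemma PT_sz {E A : Type} {cE : code E} {cA : code A} (f : E -> A) :
  PT f -> PT (fun e => sz (f e)).
Proof.
move=> Hf.
have H : PT (fun x : tree => iter (tsize x) succn 0).
  have Hn : PT (fun x : tree => (x, 0)) by apply: PT_pair PT_id (PT_const 0).
  apply: (red_trans Hn).
  apply: (red_iter (n := id) (b := fun=> 0) (PT_succ (PT_id (cA := code_nat)))).
  apply: (@pbnd_le _ _ (fun ik => 2 * (tsize (sval ik).1 + tsize (enc 0)) + 1)).
    move=> [[x k] /= kx]; rewrite iter_succn.
    rewrite [tsize _](_ : _ = sz (0 + k)) // sz_nat; lia.
  apply: pbnd_add; last exact: pbnd_const.
  by apply: pbnd_mul; [exact: pbnd_const | exact: pbnd_refl].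
have Hf' : PT (fun e => enc (f e)) by exact: Hf.
by apply: PT_ext (PT_comp H Hf') _ => e; rewrite iter_succn.
Qed.

Lemma PT_nilp {E A : Type} {cE : code E} {cA : code A} (l : E -> seq A) :
  PT l -> PT (fun e => nilp (l e)).
Proof.
move=> Hl; apply: PT_ext (PT_case_seq Hl (PT_const true) (PT_const false)) _ =>
  e.
by case: (l e).
Qed.

(* The pairs of trees that are still to be compared; the list does not become
   empty after a mismatch. *)
Definition cmp_step (s : seq (tree * tree)) : seq (tree * tree) :=
  if s is x :: s' then
    if x.1 is Node a1 a2 then
      if x.2 is Node b1 b2 then [:: (a1, b1), (a2, b2) & s'] else s
    else if x.2 is Node _ _ then s else s'
  else s.

Lemma PT_cmp_step : PT cmp_step.
Proof.
pose T := (seq (tree * tree) * ((tree * tree) * seq (tree * tree)))%type.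
have H3 : PT (fun w : T * (tree * tree) * (tree * tree) =>
    [:: (w.1.2.1, w.2.1), (w.1.2.2, w.2.2) & w.1.1.2.2]).
  by do 2!(apply: PT_cons; first by pt_proj); pt_proj.
have H2 : PT (fun z : T * (tree * tree) =>
    if z.1.2.1.2 is Node b1 b2 then [:: (z.2.1, b1), (z.2.2, b2) & z.1.2.2]
    else z.1.1).
  by apply: (PT_case_tree _ _ H3); pt_proj.
have H2' : PT (fun y : T * (tree * tree) => y.1.1) by pt_proj.
have H1' : PT (fun y : T => if y.2.1.2 is Node _ _ then y.1 else y.2.2).
  by apply: (PT_case_tree _ _ H2'); pt_proj.
have H1 : PT (fun y : T => if y.2.1.1 is Node a1 a2 then
      if y.2.1.2 is Node b1 b2 then [:: (a1, b1), (a2, b2) & y.2.2] else y.1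
    else if y.2.1.2 is Node _ _ then y.1 else y.2.2).
  by apply: (PT_case_tree _ _ H2); pt_proj.
exact: (PT_case_seq PT_id PT_id H1).
Qed.

Lemma cmp_stepP a b : iter (tsize a) cmp_step [:: (a, b)] = [::] <-> a = b.
Proof.
split.
  have inv s : (forall x, List.In x (cmp_step s) -> x.1 = x.2) ->
      forall x, List.In x s -> x.1 = x.2.
    case: s => [|[[|a1 a2] [|b1 b2]] s] //= H x.
      by case=> [<-|/H].
    case=> [<-|xs] /=; last by apply: H; right; right.
    by congr Node; [apply: (H (a1, b1)); left | apply: (H (a2, b2)); right;
      left].
  have invs n s : (forall x, List.In x (iter n cmp_step s) -> x.1 = x.2) ->
      forall x, List.In x s -> x.1 = x.2.
    by elim: n s => //= n IH s /inv; apply: IH.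
  move=> e; apply: (invs (tsize a) [:: (a, b)] _ (a, b)); last by left.
  by rewrite e.
move=> <- {b}.
suff H : forall s, iter (tsize a) cmp_step ((a, a) :: s) = s by exact: H.
elim: a => // a IHa b IHb s.
by rewrite /= -iterS iterSr addnC iterD /= IHa IHb.
Qed.

Lemma cmp_step_sz s : sz (cmp_step s) <= sz s.
Proof.
case: s => [|[[|a1 a2] [|b1 b2]] s] //=; rewrite !sz_cons !sz_pair.
  lia.
rewrite [sz (Node a1 a2)](_ : _ = (sz a1 + sz a2).+1) //.
rewrite [sz (Node b1 b2)](_ : _ = (sz b1 + sz b2).+1) //; lia.
Qed.

Lemma PT_eqop {E : Type} {A : eqType} {cE : code E} {cA : code A} (f g : E -> A)
  :
  PT f -> PT g -> PT (fun e => f e == g e).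
Proof.
move=> Hf Hg.
have H : PT (fun x : tree * tree => nilp (iter (sz x.1) cmp_step [:: x])).
  apply: PT_nilp.
  apply: (PT_iter_add (g := fun=> 0) (f := fun x : (tree * tree) * seq
    (tree * tree) => cmp_step x.2)).
  - by apply: PT_sz; pt_proj.
  - by apply: PT_cons; [pt_proj | exact: PT_const].
  - by apply: PT_comp PT_cmp_step _; pt_proj.
  - by pbnd_arith.
  - by move=> e z; rewrite addn0; apply: cmp_step_sz.
have Hfg : PT (fun e => (enc (f e), enc (g e))) by apply: red_node Hf Hg.
apply: PT_ext (PT_comp H Hfg) _ => e /=.
apply/nilP/eqP => [H0|->]; last exact/cmp_stepP.
by apply: (@enc_inj A cA); apply/cmp_stepP.
Qed.

Lemma PT_mem {E : Type} {A : eqType} {cE : code E} {cA : code A}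
    (f : E -> A) (l : E -> seq A) :
  PT f -> PT l -> PT (fun e => f e \in l e).
Proof.
move=> Hf Hl.
apply: PT_ext (PT_has (h := fun x => x.2 == f x.1) Hl _) _.
  by apply: PT_eqop; [pt_proj | apply: PT_comp Hf _; pt_proj].
by move=> e; rewrite -has_pred1.
Qed.

#[export] Instance code_sym : code sym | 0 := code_fin sym.

Definition pstep (c : sym) (s : seq tree) : seq tree :=
  if c == inr true then
    if s is a :: s' then if s' is b :: r then Node a b :: r else s else s
  else Leaf :: s.

Definition ptree (x : seq sym) : tree := head Leaf (foldr pstep [::] x).

Lemma ptreeK : cancel (str bool) ptree.
Proof.
move=> t; rewrite /ptree -[str bool t]cats0 -[RHS]/(head Leaf [:: t]).
congr head; rewrite -[in RHS]/(foldr pstep [::] [::]).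
elim: t (@nil sym) => // a IHa b IHb x.
by rewrite /= -catA IHa IHb.
Qed.

Lemma PT_ptree : PT ptree.
Proof.
pose T := (seq sym * (sym * seq tree))%type.
have H3 : PT (fun z : T * (tree * seq tree) * (tree * seq tree) =>
    Node z.1.2.1 z.2.1 :: z.2.2).
  by apply: PT_cons; [apply: PT_node; pt_proj | pt_proj].
have H2 : PT (fun y : T * (tree * seq tree) =>
    if y.2.2 is b :: r then Node y.2.1 b :: r else y.1.2.2).
  by apply: (PT_case_seq _ _ H3); pt_proj.
have H1 : PT (fun x : T => if x.2.2 is a :: s' then
    if s' is b :: r then Node a b :: r else x.2.2 else x.2.2).
  by apply: (PT_case_seq _ _ H2); pt_proj.
have H : PT (fun x : T => pstep x.2.1 x.2.2).
  apply: PT_if; last by apply: PT_cons; [exact: PT_const | pt_proj].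
    by apply: PT_eqop; [pt_proj | exact: PT_const].
  by apply: PT_ext H1 _ => -[? [? [|? []]]].
apply: PT_ext (PT_head Leaf (PT_foldr_add (g := fun=> 2) PT_id (PT_const [::]) H
  _ _)) _.
- by pbnd_arith.
- move=> e a z /=; rewrite /pstep; case: eqP => _; last first.
    by rewrite sz_cons; rewrite [sz Leaf](_ : _ = 1) //; lia.
  case: z => [|t [|t' z]]; rewrite ?leq_addr // !sz_cons.
  rewrite [sz (Node t t')](_ : _ = (sz t + sz t').+1) //; lia.
- by [].
Qed.

Lemma PT_spine : PT spine.
Proof.
apply: red_sim (@red_refl sym tree id) _ => t; exists t; split=> //=.
by elim: t => //= a _ b ->.
Qed.

Section Dec.
Context {A B : Type} {cA : code A} {cB : code B}.
Hypotheses (HA : PT (dec (A := A))) (HB : PT (dec (A := B))).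

Lemma PT_dec_seq : PT (dec (A := seq A)).
Proof.
apply: PT_some; apply: PT_ext (PT_pmap (h := fun x : tree * tree => dec x.2)
  PT_spine _) _ => //.
by apply: PT_comp HA _; pt_proj.
Qed.

Lemma PT_dec_pair : PT (dec (A := A * B)).
Proof.
pose T := (tree * (tree * tree))%type.
have H3 : PT (fun z : T * A * B => Some (z.1.2, z.2)) by apply: PT_some;
  pt_proj.
have H2 : PT (fun y : T * A =>
    if dec (A := B) y.1.2.2 is Some b then Some (y.2, b) else None).
  apply: (PT_case_option _ _ H3); last exact: PT_const.
  by apply: PT_comp HB _; pt_proj.
have H1 : PT (fun x : T => if dec (A := A) x.2.1 is Some a then
    if dec (A := B) x.2.2 is Some b then Some (a, b) else None else None).
  apply: (PT_case_option _ _ H2); last exact: PT_const.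
  by apply: PT_comp HA _; pt_proj.
apply: PT_ext (PT_case_tree PT_id (PT_const None) H1) _.
by case=> //= a b; case: (dec a) => //= x; case: (dec b).
Qed.

Lemma PT_dec_sum : PT (dec (A := A + B)).
Proof.
pose T := (tree * (tree * tree))%type.
have Hl : PT (fun x : T * A => Some (inl x.2 : A + B)).
  by apply: PT_some; apply: PT_inl; pt_proj.
have Hr : PT (fun x : T * B => Some (inr x.2 : A + B)).
  by apply: PT_some; apply: PT_inr; pt_proj.
have H2 : PT (fun x : T =>
    if dec (A := B) x.2.2 is Some b then Some (inr b : A + B) else None).
  apply: (PT_case_option _ _ Hr); last exact: PT_const.
  by apply: PT_comp HB _; pt_proj.
have H2' : PT (fun x : T * (tree * tree) =>
    if dec (A := B) x.1.2.2 is Some b then Some (inr b : A + B) else None).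
  by apply: PT_comp H2 _; pt_proj.
have H1 : PT (fun x : T =>
    if dec (A := A) x.2.2 is Some a then Some (inl a : A + B) else None).
  apply: (PT_case_option _ _ Hl); last exact: PT_const.
  by apply: PT_comp HA _; pt_proj.
have H0 : PT (fun x : T => if x.2.1 is Node _ _ then
    if dec (A := B) x.2.2 is Some b then Some (inr b : A + B) else None
  else if dec (A := A) x.2.2 is Some a then Some (inl a : A + B) else None).
  by apply: (PT_case_tree _ H1 H2'); pt_proj.
apply: PT_ext (PT_case_tree PT_id (PT_const None) H0) _.
by case=> //= -[|? ?] b; case: (dec b).
Qed.
End Dec.

Lemma PT_dec_bool : PT (dec (A := bool)).
Proof.
apply: PT_some.
apply: PT_ext (PT_case_tree PT_id (PT_const false) (PT_const true)) _.
by case.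
Qed.

Lemma PT_dec_fin (F : finType) (cF := code_fin F) : PT (dec (A := F)).
Proof.
apply: PT_ext (PT_nat_table (N := #|F|) (f := fun k _ =>
  nth None (map Some (enum F)) k) (PT_size PT_spine) _) _.
  by move=> k _; apply: PT_const.
move=> t /=; rewrite /dec_fin; case: (leqP #|F| (size (spine t))) => // le.
by rewrite !nth_default // size_map -cardE.
Qed.

(** * Machines deciding polynomial-time predicates *)

Lemma tm_result_mono (S : finType) (M : tm S) xs n m b :
  n <= m -> tm_result M xs n = Some b -> tm_result M xs m = Some b.
Proof.
rewrite /tm_result => nm H.
by rewrite -(subnK nm) iterD tm_stepK // H.
Qed.

Local Notation G := (sym + bool)%type.

Fixpoint pushes (n : nat) (w : seq G) : cmd sym :=
  if w is g :: w' then Seq (pushes n w') (Push n g) else Skip sym.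

Lemma exec_pushes n w s :
  exec (pushes n w) s (2 * size w + 1) (upd s n (w ++ s n)).
Proof.
elim: w => [|g w IH] /=.
  apply: exec_le (exec_skip _) _ _ => //.
  by apply: functional_extensionality => j; rewrite /upd; case: eqP => [->|].
apply: exec_le (exec_seq IH (exec_push _ _ _)) _ _; last by rewrite /=; lia.
by apply: functional_extensionality => j; rewrite /upd eqxx; case: eqP.
Qed.

Definition letter_code (a : sym) : seq G := inr true :: str sym (enc a).

Definition letter_max : nat := (2 * #|sym|.*2.+1).+1.

Lemma size_letter_code a : 2 * size (letter_code a) + 1 <= letter_max.
Proof.
have H : sz a <= #|sym|.*2 by exact: sz_fin.
rewrite [size _](_ : _ = (sz a).+1); last by rewrite /= size_str.
rewrite /letter_max; lia.
Qed.

Definition recode_loop (n : nat) : cmd sym :=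
  While n.+1 (Case n.+1 (fun o =>
    if o is Some (inl a) then pushes n (letter_code a) else Skip sym)).

Lemma exec_recode_loop n y s : s n.+1 = map inl y ->
  exec (recode_loop n) s (size y * (letter_max + 2) + 1)
    (upd (upd s n.+1 [::]) n (flatten (map letter_code (rev y)) ++ s n)).
Proof.
elim: y s => [|a y IH] s e.
  apply: exec_eq (exec_stop _ e) _.
  apply: functional_extensionality => j; rewrite /upd.
  by case: eqP => [->|_] //; case: eqP => [->|].
pose s1 := upd (upd s n.+1 (map inl y)) n (letter_code a ++ s n).
have e1 : s1 n.+1 = map inl y.
  by rewrite /s1 /upd; case: eqP => [?|_]; [lia | rewrite eqxx].
apply: exec_le (exec_loop _ _ (IH s1 e1)) _ _; first by rewrite e.
- apply: exec_case; rewrite e.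
  apply: exec_le (exec_pushes n (letter_code a) _) _ _.
    apply: functional_extensionality => j; rewrite /s1 /upd.
    by case: (n =P n.+1) => [?|_] //; lia.
  exact: size_letter_code.
- apply: functional_extensionality => j; rewrite /s1 /upd eqxx.
  case: eqP => // _; last by case: eqP.
  by rewrite rev_cons map_rcons flatten_rcons catA.
- by rewrite /= mulSn; lia.
Qed.

Definition recode1 (j n : nat) : cmd sym :=
  Seq (Push n (inr false)) (Seq (mv sym j n.+1)
    (Seq (recode_loop n) (Push n (inr true)))).

Lemma str_word (x : seq sym) :
  str sym (enc x) = flatten (map letter_code x) ++ [:: inr false].
Proof. by elim: x => //= a x IH; rewrite -catA -IH. Qed.

Lemma exec_recode1 j n x s : j < n -> s j = map inl x -> s n.+1 = [::] ->
  exec (recode1 j n) s (size x * (letter_max + 6) + 6)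
    (upd (upd s j [::]) n (inr true :: str sym (enc x) ++ s n)).
Proof.
move=> jn ej en.
have H1 := exec_push n (inr false) s.
have jn1 : j != n.+1 by lia.
have H2 := exec_mv (upd s n (inr false :: s n)) jn1.
set s2 := upd (upd _ j _) n.+1 _ in H2.
have e2 : s2 n.+1 = map inl (rev x).
  rewrite /s2 /upd eqxx; case: eqP => [?|_]; first by lia.
  by case: eqP => [?|_]; [lia | rewrite ej en cats0 map_rev].
have H3 := exec_recode_loop e2.
have H4 := exec_push n (inr true) (upd (upd s2 n.+1 [::]) n
             (flatten (map letter_code (rev (rev x))) ++ s2 n)).
apply: exec_le (exec_seq H1 (exec_seq H2 (exec_seq H3 H4))) _ _.
- apply: functional_extensionality => i; rewrite /s2 /upd eqxx revK str_word
    -catA.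
  have -> : (n == n.+1) = false by lia.
  have -> : (n == j) = false by lia.
  case: (i == n) => //; case: (i =P n.+1) => [->|_] //.
  by rewrite en; case: eqP.
- rewrite size_rev /upd; case: eqP => [?|_]; first by lia.
  by rewrite ej size_map; lia.
Qed.

Fixpoint recode (k n : nat) : cmd sym :=
  if k is k'.+1 then Seq (recode1 k' n) (recode k' n) else Skip sym.

Lemma exec_recode k n xs s N : k <= n -> size xs = n ->
  (forall x, x \in xs -> size x <= N) ->
  (forall i, i < k -> s i = map inl (nth [::] xs i)) ->
  (forall i, k <= i -> i != n -> s i = [::]) ->
  s n = str sym (enc (drop k xs)) ->
  exec (recode k n) s (k * (N * (letter_max + 6) + 6) + 1)
    (upd (fun=> [::]) n (str sym (enc xs))).
Proof.
move=> kn sx HN; elim: k kn s => [|k IH] kn s H1 H2 H3.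
  apply: exec_eq (exec_skip _) _.
  apply: functional_extensionality => i; rewrite /upd.
  by case: eqP => [->|/eqP ni]; [rewrite H3 drop0 | apply: H2].
have e1 := @exec_recode1 k n (nth [::] xs k) s kn (H1 k (ltnSn k)).
apply: exec_weak.
  apply: exec_seq (e1 _) (IH (ltnW kn) _ _ _ _).
  - by apply: H2; lia.
  - move=> i ik; rewrite /upd; case: eqP => [?|_]; first by lia.
    case: eqP => [?|_]; first by lia.
    by apply: H1; lia.
  - move=> i ki ni; rewrite /upd (negPf ni); case: eqP => // /eqP ik.
    by apply: H2 => //; lia.
  - by rewrite /upd eqxx H3 [drop k xs](drop_nth [::]) ?sx.
have : size (nth [::] xs k) <= N by apply: HN; rewrite mem_nth ?sx.
rewrite mulSn -addnA; set a := size _ => aN.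
have : a * (letter_max + 6) <= N * (letter_max + 6) by rewrite leq_mul2r aN
  orbT.
lia.
Qed.

Lemma sz_word (x : seq sym) : sz x <= size x * letter_max + 1.
Proof.
elim: x => // a x IHx.
rewrite sz_cons [size (a :: x)](_ : _ = (size x).+1) // mulSn.
have : sz a <= #|sym|.*2 by exact: sz_fin.
have : #|sym|.*2.+1 <= letter_max by rewrite /letter_max; lia.
lia.
Qed.

Lemma sz_words (xs : seq (seq sym)) n N : size xs = n ->
  (forall x, x \in xs -> size x <= N) ->
  sz xs <= n * (N * letter_max + 2) + 1.
Proof.
move=> <-; elim: xs => // x xs IH H.
rewrite sz_cons [size (x :: xs)](_ : _ = (size xs).+1) // mulSn.
have := IH (fun y yx => H y (mem_behead (s := x :: xs) yx)).
have := H x (mem_head _ _).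
have := sz_word x.
move=> H1 H2; have : size x * letter_max <= N * letter_max.
  by rewrite leq_mul2r H2 orbT.
lia.
Qed.

Lemma mem_size_sumn (xs : seq (seq sym)) x :
  x \in xs -> size x <= sumn (map size xs).
Proof.
elim: xs => //= y xs IH; rewrite inE => /orP [/eqP <-|/IH]; lia.
Qed.

Theorem PT_decided (f : seq (seq sym) -> bool) (n : nat) : PT f ->
  exists2 M : tm sym, poly_time M n &
    forall xs, size xs = n -> tm_accepts M xs <-> f xs.
Proof.
move=> [p Pp Hp]; have [c Hc] := Hp n.
pose main := Seq (Seq (Push n (inr false)) (recode n n)) c.
pose T N := (n * (N * (letter_max + 6) + 6) + 3) + p (n * (N * letter_max + 2) +
  1) + 1.
have H xs : size xs = n -> forall m, T (sumn (map size xs)) <= m ->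
    tm_result (cmachine main n) xs m = Some (f xs).
  move=> sx m; rewrite /T; set N := sumn _ => le.
  have HN x : x \in xs -> size x <= N by apply: mem_size_sumn.
  pose s0 : regs sym := fun i => map inl (nth [::] xs i).
  have E1 : exec (Seq (Push n (inr false)) (recode n n)) s0
      (2 + (n * (N * (letter_max + 6) + 6) + 1))
        (upd (fun=> [::]) n (str sym (enc xs))).
    apply: exec_seq (exec_push _ _ _) (exec_recode (leqnn n) sx HN _ _ _).
    - by move=> i ni; rewrite /upd; case: eqP => [?|_] //; lia.
    - by move=> i ni /negPf e; rewrite /upd e /s0 nth_default // sx.
    - by rewrite /upd eqxx /s0 nth_default ?sx // drop_oversize ?sx.
  have E2 := Hc xs (fun=> [::]).
  have est y : st (fun=> [::]) n [:: y] = upd (fun=> [::]) n y :> regs sym.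
    apply: functional_extensionality => i; rewrite /st /upd.
    case: ltnP => ni; first by case: eqP => // ?; lia.
    case: eqP => [->|ne]; first by rewrite subnn.
    by rewrite nth_default //=; lia.
  rewrite !est in E2.
  have E := exec_seq E1 E2.
  rewrite (cmachine_result n E); last first.
    apply: leq_trans le; rewrite [ltnRHS]addn1 ltnS; apply: leq_add;
      first by lia.
    by apply: (ispoly_mono Pp); apply: sz_words.
  by rewrite /upd eqxx; case: (f xs).
exists (cmachine main n).
  have PT' : ispoly T.
    do ?[apply: ispoly_add | apply: ispoly_mul | apply: ispoly_const
       | apply: ispoly_id | apply: (ispoly_comp Pp)].
  have [d Hd] := ispoly_leXD PT'.
  by exists d => xs sx; rewrite (H xs sx _ (Hd _)).
move=> xs sx; split.
  move=> [m Hm].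
  have := tm_result_mono (leq_addr (T (sumn (map size xs))) m) Hm.
  by rewrite (H xs sx) ?leq_addl // => -[].
by move=> fx; exists (T (sumn (map size xs))); rewrite H // fx.
Qed.

(** * Simulation of a machine *)

Lemma sz_behead {A : Type} {cA : code A} (l : seq A) : sz (behead l) <= sz l.
Proof. by case: l => // x l; rewrite sz_cons /=; lia. Qed.

Lemma sz_tape_moves {A : Type} {cA : code A} (a0 a : A) (l r : seq A) (L : nat)
  :
  (forall x : A, sz x <= L) ->
  [/\ sz (behead l, head a0 l :: a :: behead r) <= sz (l, r) + (L + L + 2),
      sz (l, a :: behead r) <= sz (l, r) + (L + L + 2) &
      sz (a :: l, behead r) <= sz (l, r) + (L + L + 2)].
Proof.
move=> sL; have Ha := sL a; have H0 := sL (head a0 l).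
have Hl : sz (behead l) <= sz l by exact: sz_behead.
have Hr : sz (behead r) <= sz r by exact: sz_behead.
by split; rewrite !sz_pair !sz_cons; lia.
Qed.

Section Simulation.
Variable M : tm sym.
Let F : finType := option (sym + tm_extra M)%type.
Let Q : finType := tm_state M.
Let K := tm_tapes M.
#[local] Instance code_letter : code F := code_fin F.
#[local] Instance code_state : code Q := code_fin Q.
Let ltape : Type := (seq F * seq F)%type.
Let act (a : F * move) (t : ltape) : ltape := shift a.2 (write a.1 t : tape _).

Fixpoint act_all (w : seq (F * move)) (ts : seq ltape) : seq ltape :=
  match w, ts with
  | a :: w', t :: ts' => act a t :: act_all w' ts'
  | _, _ => [::]
  end.

Definition sim_heads (ts : seq ltape) : seq F := [seq head None t.2 | t <- ts].

Definition sim_delta (q : Q) (w : seq F) : Q * seq (F * move) :=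
  let d := tm_delta q [ffun i : 'I_K => nth None w i] in
  (d.1, [seq d.2 i | i <- enum 'I_K]).

Definition sim_step (c : Q * seq ltape) : Q * seq ltape :=
  if tm_out c.1 then c else
  let d := sim_delta c.1 (take K (sim_heads c.2)) in (d.1, act_all d.2 c.2).

Definition sim_config (c : config M) : Q * seq ltape :=
  (c.1, [seq c.2 i | i <- enum 'I_K]).

Lemma act_all_map (I : Type) (f : I -> F * move) (T : I -> ltape) (s : seq I) :
  act_all (map f s) (map T s) = [seq act (f i) (T i) | i <- s].
Proof. by elim: s => //= i s ->. Qed.

Lemma sim_stepE (c : config M) : sim_step (sim_config c) =
  sim_config (tm_step c).
Proof.
case: c => q T; rewrite /sim_step /tm_step /=; case: tm_out => //=.
have -> : [ffun i : 'I_K =>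
  nth None (take K (sim_heads [seq T i | i <- enum 'I_K])) i]
    = [ffun i => read (T i)].
  apply/ffunP => i; rewrite !ffunE take_oversize; last first.
    by rewrite 2!size_map size_enum_ord.
  rewrite (nth_map ([::], [::])); last by rewrite size_map size_enum_ord.
  by rewrite (nth_map i) ?size_enum_ord // nth_ord_enum.
by rewrite /sim_config; congr (_, _); apply: act_all_map.
Qed.

Lemma sim_iter (c : config M) n :
  iter n sim_step (sim_config c) = sim_config (iter n (@tm_step _ M) c).
Proof. by elim: n => //= n ->; rewrite sim_stepE. Qed.

Lemma PT_act a : PT (act a).
Proof.
have Hw : PT (fun t : ltape => (t.1, a.1 :: behead t.2)).
  by apply: PT_pair; [pt_proj | apply: PT_cons;
    [exact: PT_const | apply: PT_behead; pt_proj]].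
case: a Hw => a [] /= Hw; last first.
- apply: PT_pair; last by do 2?apply: PT_behead; apply: PT_snd Hw.
  by apply: PT_cons; [apply: PT_head; apply: PT_snd Hw | pt_proj].
- exact: Hw.
- apply: PT_pair; first by apply: PT_behead; pt_proj.
  by apply: PT_cons; [apply: PT_head; pt_proj | apply: PT_snd Hw].
Qed.

Lemma PT_act_all w : PT (act_all w).
Proof.
elim: w => [|a w IH]; first exact: PT_const.
have H : PT (fun x : seq ltape * (ltape * seq ltape) =>
    act a x.2.1 :: act_all w x.2.2).
  apply: PT_cons; first by apply: PT_comp (PT_act a) _; pt_proj.
  by apply: PT_comp IH _; pt_proj.
exact: PT_case_seq PT_id (PT_const [::]) H.
Qed.

Lemma PT_sim_step : PT sim_step.
Proof.
have Hheads : PT sim_heads.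
  apply: PT_ext (PT_map (h := fun x : seq ltape * ltape => head None x.2.2)
    PT_id _) _ => //.
  by apply: PT_head; pt_proj.
apply: (PT_fin (x := fun c : Q * seq ltape => c.1) (f := fun q c =>
  if tm_out q then c else
  let d := sim_delta q (take K (sim_heads c.2)) in (d.1, act_all d.2 c.2))).
  by pt_proj.
move=> q; case: (tm_out q) => [b|]; first exact: PT_id.
apply: (@PT_fin_seq _ _ F K _ _ (fun c : Q * seq ltape => sim_heads c.2)
  (fun w c => let d := sim_delta q w in (d.1, act_all d.2 c.2))).
  by apply: PT_comp Hheads _; pt_proj.
move=> w; apply: PT_pair; first exact: PT_const.
by apply: PT_comp (PT_act_all _) _; pt_proj.
Qed.

Let L := #|F|.*2.

Lemma sz_act a t : sz (act a t) <= sz t + (L + L + 2).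
Proof.
have sL (x : F) : sz x <= L by exact: sz_fin.
case: a t => a m [l r]; have [HL HN HR] := sz_tape_moves None a l r sL.
by case: m.
Qed.

Lemma sz_act_all w ts : sz (act_all w ts) <= sz ts + size w * (L + L + 2).
Proof.
elim: w ts => [|a w IH] [|t ts]; try exact: leq_addr.
apply: (@leq_trans (sz t + (L + L + 2) + (sz ts + size w * (L + L + 2))).+1).
  exact: leq_add (sz_act a t) (IH ts).
rewrite !sz_cons [size (a :: w)](_ : _ = (size w).+1) // mulSn; lia.
Qed.

Lemma sz_sim_step c : sz (sim_step c) <= sz c + (#|Q|.*2 + K * (L + L + 2)).
Proof.
rewrite /sim_step; case: (tm_out c.1) => [b|]; first exact: leq_addr.
case: c => q ts.
apply: (@leq_trans (#|Q|.*2 + (sz ts + K * (L + L + 2))).+1); last first.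
  by rewrite [in leqRHS]sz_pair; lia.
apply: leq_add; first exact: sz_fin.
by apply: leq_trans (sz_act_all _ _) _; rewrite size_map size_enum_ord.
Qed.

Lemma PT_tm_result {E : Type} {cE : code E} (xs : E -> seq (seq sym)) (n : E ->
  nat) :
  PT xs -> PT n -> PT (fun e => tm_result M (xs e) (n e) == Some true).
Proof.
move=> Hxs Hn.
pose ini (xs : seq (seq sym)) : Q * seq ltape := (tm_start M,
  [seq (tape_of (map inl (nth [::] xs i)) : ltape) | i <- iota 0 K]).
have Htape : PT (fun x : seq sym => tape_of (map inl x) : ltape).
  apply: PT_pair; first exact: PT_const.
  have H : PT (fun x : seq sym * sym => Some (inl x.2) : F).
    apply: (PT_fin (x := fun x : seq sym * sym => x.2) (f := fun a _ =>
      Some (inl a) : F)).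
      by pt_proj.
    by move=> a; apply: PT_const.
  apply: PT_ext (PT_map PT_id H) _ => x.
  by rewrite -map_comp.
have Hini : PT ini.
  apply: PT_pair; first exact: PT_const.
  elim: (iota 0 K) => [|i s IH]; first exact: PT_const.
  by apply: PT_cons IH; apply: PT_comp Htape _; apply: PT_nth PT_id.
have Hrun : PT (fun e => iter (n e) sim_step (ini (xs e))).
  apply: PT_ext (PT_iter_add (f := fun x => sim_step x.2)
    (g := fun=> #|Q|.*2 + K * (L + L + 2)) Hn (PT_comp Hini Hxs) _ _ _) _ => //.
  - by apply: PT_comp PT_sim_step _; pt_proj.
  - by pbnd_arith.
  - by move=> e z; apply: sz_sim_step.
have H : PT (fun e => tm_out (iter (n e) sim_step (ini (xs e))).1 == Some true).
  apply: (PT_fin (f := fun q _ => tm_out q == Some true) (PT_fst Hrun)).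
  by move=> q; apply: PT_const.
apply: PT_ext H _ => e /=; rewrite /tm_result.
have -> : ini (xs e) = sim_config (tm_init M (xs e)).
  rewrite /ini /sim_config /tm_init /=; congr pair.
  by rewrite -val_enum_ord -map_comp.
by rewrite sim_iter.
Qed.
End Simulation.

Lemma in_NP_PT (L : seq sym -> Prop) : in_NP L ->
  exists (V : seq sym -> seq sym -> bool) (d : nat),
    [/\ PT (fun x : seq sym * seq sym => V x.1 x.2),
        forall x u, V x u -> size u <= size x ^ d + d &
        forall x, L x <-> exists u, V x u].
Proof.
move=> [M [dt Hdt] [d Hd]].
(* The length of the certificate has to be tested: [M] may accept longer ones
   for words outside [L]. *)
pose V (x u : seq sym) := (size u <= size x ^ d + d) &&
  (tm_result M [:: x; u] ((size x + size u) ^ dt + dt) == Some true).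
exists V, d; split.
- apply: PT_and.
    apply: PT_leq; first by apply: PT_size; pt_proj.
    apply: PT_addn (PT_const d); apply: PT_expn; apply: PT_size; pt_proj.
  apply: PT_tm_result.
    by do 2!(apply: PT_cons; first by pt_proj); exact: PT_const.
  apply: PT_addn (PT_const dt); apply: PT_expn.
  by apply: PT_addn; apply: PT_size; pt_proj.
- by move=> x u /andP [].
move=> x; split.
  move=> /Hd [u [su [n Hn]]]; exists u; rewrite /V su /=.
  have := Hdt [:: x; u] (erefl _); rewrite /= addn0.
  set m := _ + dt; case E : (tm_result M _ m) => [b|] // _.
  have := tm_result_mono (leq_addr m n) Hn.
  by rewrite (tm_result_mono (leq_addl n m) E) => ->.
move=> [u /andP [su /eqP Hu]]; apply/Hd; exists u; split=> //.
by eexists; exact: Hu.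
Qed.

(** * Unique decoding *)

Definition prefix_free (A : Type) (f : A -> seq sym) : Prop :=
  forall a b x y, f a ++ x = f b ++ y -> a = b /\ x = y.

Lemma prefix_free_word : prefix_free enc_word.
Proof.
move=> a b x y; rewrite /enc_word /brackets /= !cat_rcons => -[].
elim: a b => [|c a IH] [|c' b] //= [].
  by move->.
by move=> -> /IH [-> ->].
Qed.

Lemma prefix_free_seq (A : Type) (f : A -> seq sym) :
  prefix_free f -> (forall a, ohead (f a) = Some (inr true)) ->
  prefix_free (fun l => brackets (flatten (map f l))).
Proof.
move=> Hf H a b x y; rewrite /brackets /= !cat_rcons => -[].
elim: a b => [|c a IH] [|c' b] /=.
- by case=> ->.
- by have := H c'; case: (f c') => //= ? ? [->].
- by have := H c; case: (f c) => //= ? ? [->].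
- by rewrite -!catA => /Hf [-> /IH [-> ->]].
Qed.

Lemma prefix_free_celem r : prefix_free (@enc_celem r).
Proof.
have wordN u (i : 'I_r) (t : seq word) (x y : seq sym) :
    enc_word u ++ x <> enc_celem (inr (i, t)) ++ y.
  by rewrite /enc_celem /enc_word /brackets /= => -[]; case: u.
case=> [u|[i t]] [v|[j t']] x y.
- by move=> /prefix_free_word [-> ->].
- by move=> /wordN.
- by move=> /esym /wordN.
move=> H; have : enc_word (nseq i true) ++ flatten (map enc_word t) ++
  inr false :: x =
    enc_word (nseq j true) ++ flatten (map enc_word t') ++ inr false :: y.
  by case: H; rewrite /= -!cats1 /= -!catA => ->.
move=> /prefix_free_word [eij e].
have -> : i = j by apply: val_inj; have /= := congr1 size eij;
  rewrite !size_nseq.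
have := @prefix_free_seq _ _ prefix_free_word (fun=> erefl) t t' x y.
by rewrite /brackets /= !cat_rcons e => /(_ erefl) [-> ->].
Qed.

Lemma ohead_celem r (e : celem r) : ohead (enc_celem e) = Some (inr true).
Proof. by case: e => [u|[i t]]. Qed.

Lemma prefix_free_set r : prefix_free (@enc_set r).
Proof. exact: prefix_free_seq (@prefix_free_celem r) (@ohead_celem r). Qed.

(** * The checks of the verifier *)

Section Checks.
Variable r : nat.
Implicit Types (E s t : seq (celem r))
  (D : seq (seq (celem r) * seq (celem r))).

Local Open Scope fset_scope.

Definition supported_in E (e : celem r) : bool :=
  match e with
  | inl _ => true
  | inr it => all (fun u => (inl u : celem r) \in E) it.2
  end.

Definition scenario_seq E := [seq e <- E | supported_in E e].

Lemma in_to_fset E e : (e \in to_fset E) = (e \in E).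
Proof. by rewrite !inE. Qed.

Lemma supported_to_fset E e : supported (to_fset E) e = supported_in E e.
Proof.
by case: e => [u|[i w]] //=; apply: eq_all => u; rewrite in_to_fset.
Qed.

Lemma to_fset_scenario E : to_fset (scenario_seq E) = scenario (to_fset E).
Proof.
apply/fsetP => e; rewrite in_to_fset mem_filter !inE /= supported_to_fset.
by rewrite andbC.
Qed.

Lemma scenario_instance (E : {fset celem r}) : is_instance (scenario E).
Proof.
move=> [u|[i w]] //; rewrite !inE /= => /andP [_ /allP H].
by apply/allP => u /H; rewrite !inE /= => ->.
Qed.

Lemma to_fset_cat E E' : to_fset (E ++ E') = to_fset E `|` to_fset E'.
Proof. by apply/fsetP => e; rewrite inE !in_to_fset mem_cat. Qed.

Lemma to_fset_flatten (L : seq (seq (celem r))) :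
  to_fset (flatten L) = \bigcup_(A <- map (@to_fset r) L) A.
Proof.
elim: L => [|E L IH] /=; first by rewrite big_nil; apply/fsetP => e;
  rewrite in_to_fset inE.
by rewrite big_cons -IH to_fset_cat.
Qed.

Definition hdist s t : nat :=
  size (undup [seq e <- s | is_univ e && (e \notin t)]) +
  size (undup [seq e <- t | is_univ e && (e \notin s)]).

Lemma card_to_fset s : #|` to_fset s| = size (undup s).
Proof.
have -> : to_fset s = seq_fset tt (undup s).
  by apply/fsetP => e; rewrite in_to_fset seq_fsetE mem_undup.
by rewrite size_seq_fset undup_id ?undup_uniq.
Qed.

Lemma hammingE s t : hamming (to_fset s) (to_fset t) = hdist s t.
Proof.
rewrite /hamming /symdiff cardfsU.
have -> : (univ_part (to_fset s) `\` univ_part (to_fset t))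
    `&` (univ_part (to_fset t) `\` univ_part (to_fset s)) = fset0.
  apply/fsetP => e; rewrite !inE; case: (e \in s); case: (e \in t) => //=;
  by rewrite ?andbF ?andbT //=; case: is_univ.
rewrite cardfs0 subn0 /hdist; congr addn; rewrite -card_to_fset; congr (#|` _|);
  apply/fsetP => e; rewrite in_to_fset mem_filter !inE;
  by case: (e \in s); case: (e \in t); case: (is_univ e).
Qed.

Definition le_bits (h : nat) (b : seq bool) : bool :=
  if b is sg :: b' then
    if sg then (h == 0) && ~~ has id b'
    else foldl (fun k (c : bool) => uphalf (k - c)) h b' == 0
  else false.

Lemma le_bitsE h sg b : le_bits h (sg :: b) = (h%:Z <= int_of_bits sg b)%R.
Proof.
rewrite /int_of_bits; set f := foldr _ _.
have -> : le_bits h (sg :: b) = if sg then (h == 0) && (f b == 0) else h <= f b.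
  rewrite /=; case: sg.
    by congr andb; elim: b => //= -[] //= b ->; rewrite add0n double_eq0.
  elim: b h => [|c b IH] h /=; first by rewrite leqn0.
  by rewrite IH; case: c; lia.
by case: sg; lia.
Qed.

Definition disjoint_sets E D : bool :=
  uniq (flatten (map undup (E :: flatten [seq [:: d.1; d.2] | d <- D]))).

Lemma disjoint_setsE E D : disjoint_sets E D =
  xor_disjoint (to_fset E) [seq (to_fset d.1, to_fset d.2) | d <- D].
Proof.
rewrite /disjoint_sets /xor_disjoint.
have -> : to_fset E :: flatten [seq [:: d.1; d.2] |
      d <- [seq (to_fset d.1, to_fset d.2) | d <- D]] =
    map (@to_fset r) (E :: flatten [seq [:: d.1; d.2] | d <- D]).
  by congr cons; elim: D => //= d D ->.
elim: (E :: _) => //= {E D} E L <-; rewrite cat_uniq undup_uniq /=.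
congr (_ && _); rewrite all_map; apply/hasPn/allP => [H A AL | H e].
  apply/fdisjointP => e; rewrite !in_to_fset => eE; apply/negP => eA.
  suff /H : e \in flatten (map undup L) by rewrite mem_undup eE.
  by apply/flattenP; exists (undup A); [apply: map_f | rewrite mem_undup].
move=> /flattenP [_ /mapP [A AL ->]]; rewrite !mem_undup => eA.
have /fdisjointP /(_ e) := H A AL; rewrite !in_to_fset eA.
by case: (e \in E) => // /(_ isT).
Qed.

Definition pick1 (u : seq sym) (d : seq (celem r) * seq (celem r)) :=
  if head (inl false) u == inl true then d.2 else d.1.

Fixpoint picks D (u : seq sym) : seq (seq (celem r)) :=
  if D is d :: D' then pick1 u d :: picks D' (behead u) else [::].

Lemma picks_scenario E D u :
  xor_scenarios (to_fset E) [seq (to_fset d.1, to_fset d.2) | d <- D]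
    (to_fset (E ++ flatten (picks D u))).
Proof.
exists (map (@to_fset r) (picks D u)); last by rewrite to_fset_cat
  to_fset_flatten.
elim: D u => //= d D IH u; rewrite IH andbT /pick1.
by case: ifP => _; rewrite eqxx ?orbT.
Qed.

Lemma scenario_picks E D A :
  xor_scenarios (to_fset E) [seq (to_fset d.1, to_fset d.2) | d <- D] A ->
  exists2 u, size u = size D & A = to_fset (E ++ flatten (picks D u)).
Proof.
case=> C HC ->; suff [u su e] : exists2 u, size u = size D &
    C = map (@to_fset r) (picks D u).
  by exists u => //; rewrite to_fset_cat to_fset_flatten e.
elim: D C HC => [|d D IH] [|B C] //=; first by exists [::].
move=> /andP [HB /IH [u su ->]]; case: eqP HB => [-> _|_ /= /eqP ->].
  by exists (inl false :: u) => //=; rewrite su.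
by exists (inl true :: u) => //=; rewrite su.
Qed.
End Checks.

Section PTChecks.
Variable r : nat.
Local Notation elem := (word + 'I_r * seq word)%type.
#[local] Instance code_index : code 'I_r := code_fin 'I_r.
#[export] Instance code_elem : code (celem r) := (code_sum : code elem).
Local Notation vset := (seq (celem r)).

Lemma PT_brackets {E : Type} {cE : code E} (f : E -> seq sym) :
  PT f -> PT (fun e => brackets (f e)).
Proof.
move=> Hf; apply: PT_cons; first exact: PT_const.
apply: PT_ext (PT_cat Hf (PT_const [:: inr false])) _ => e.
by rewrite cats1.
Qed.

Lemma PT_enc_word : PT enc_word.
Proof.
apply: PT_brackets.
apply: (PT_map (h := fun x : word * bool => inl x.2 : sym) PT_id).
have H : PT (fun x : word * bool => if x.2 then (inl true : sym) else inl
  false).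
  by apply: PT_if; [pt_proj | exact: PT_const | exact: PT_const].
by apply: PT_ext H _ => -[? []].
Qed.

Lemma PT_flatten_map {E A B : Type} {cE : code E} {cA : code A} {cB : code B}
    (f : A -> seq B) (l : E -> seq A) :
  PT f -> PT l -> PT (fun e => flatten (map f (l e))).
Proof.
move=> Hf Hl; apply: PT_flatten.
by apply: (PT_map (h := fun x => f x.2)) => //; apply: PT_comp Hf _; pt_proj.
Qed.

Lemma PT_enc_celem : PT (@enc_celem r).
Proof.
have H1 : PT (fun x : elem * word => enc_word x.2) by apply: PT_comp PT_enc_word
  _; pt_proj.
have H0 : PT (fun x : elem * ('I_r * seq word) => enc_word (nseq x.2.1 true)).
  apply: (PT_fin (x := fun x : elem * ('I_r * seq word) => x.2.1)
    (f := fun i _ => enc_word (nseq i true))); first by pt_proj.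
  by move=> i; apply: PT_const.
have H2 : PT (fun x : elem * ('I_r * seq word) =>
    brackets (enc_word (nseq x.2.1 true) ++ flatten (map enc_word x.2.2))).
  apply: PT_brackets; apply: PT_cat => //.
  by apply: PT_flatten_map PT_enc_word _; pt_proj.
apply: PT_ext (PT_case_sum (PT_id (A := elem)) H1 H2) _.
by case=> [u|[i t]].
Qed.

Lemma PT_enc_set : PT (@enc_set r).
Proof. by apply: PT_brackets; apply: PT_flatten_map PT_enc_celem PT_id. Qed.

Lemma PT_enc_deps : PT (@enc_deps r).
Proof.
apply: PT_brackets; apply: (PT_flatten_map (f := fun d : vset * vset =>
  enc_set d.1 ++ enc_set d.2)) PT_id.
by apply: PT_cat; apply: PT_comp PT_enc_set _; pt_proj.
Qed.

Lemma PT_is_univ : PT (@is_univ r).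
Proof.
apply: PT_ext (PT_case_sum (PT_id (A := elem)) (PT_const true) (PT_const false))
  _.
by case.
Qed.

Lemma PT_supported_in : PT (fun x : vset * celem r => supported_in x.1 x.2).
Proof.
pose T := (vset * celem r)%type.
have H2 : PT (fun x : T * ('I_r * seq word) =>
    all (fun u => (inl u : celem r) \in x.1.1) x.2.2).
  apply: (PT_all (h := fun y : T * ('I_r * seq word) * word =>
    (inl y.2 : celem r) \in y.1.1.1)); first by pt_proj.
  apply: PT_mem; last by pt_proj.
  by apply: (PT_inl (A := word) (B := 'I_r * seq word)); pt_proj.
have Ht : PT (fun x : T => (x.2 : elem)) by apply: PT_snd PT_id.
apply: PT_ext (PT_case_sum Ht (PT_const true) H2) _.
by case=> E [u|[i t]].
Qed.

Lemma PT_scenario : PT (@scenario_seq r).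
Proof. exact: (PT_filter (h := fun x => supported_in x.1 x.2) PT_id
  PT_supported_in). Qed.

Lemma PT_undup {E : Type} {A : eqType} {cE : code E} {cA : code A} (l : E ->
  seq A) :
  PT l -> PT (fun e => undup (l e)).
Proof.
move=> Hl.
apply: PT_ext (PT_foldr_add (f := fun x : E * (A * seq A) =>
    if x.2.1 \in x.2.2 then x.2.2 else x.2.1 :: x.2.2)
  (g := fun x : E * A => sz x + 1) Hl (PT_const [::]) _ _ _) _.
- apply: PT_if; first by apply: PT_mem; pt_proj.
    by pt_proj.
  by apply: PT_cons; pt_proj.
- by pbnd_arith.
- by move=> e a z /=; rewrite sz_pair; case: ifP => _; rewrite ?sz_cons; lia.
- by move=> e /=; elim: (l e) => //= a s ->; rewrite mem_undup.
Qed.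

Lemma PT_hdist : PT (fun x : vset * vset => hdist x.1 x.2).
Proof.
have H : PT (fun x : vset * vset =>
    size (undup [seq e <- x.1 | is_univ e && (e \notin x.2)])).
  apply: PT_size; apply: PT_undup.
  apply: (PT_filter (h := fun y : vset * vset * celem r =>
    is_univ y.2 && (y.2 \notin y.1.2))); first by pt_proj.
  apply: PT_and; first by apply: PT_comp PT_is_univ _; pt_proj.
  by apply: PT_neg; apply: PT_mem; pt_proj.
apply: PT_addn => //.
by apply: (PT_comp H (g := fun x : vset * vset => (x.2, x.1))); pt_proj.
Qed.

Lemma PT_le_bits : PT (fun x : nat * seq bool => le_bits x.1 x.2).
Proof.
pose T := (nat * seq bool * (bool * seq bool))%type.
have H1 : PT (fun y : T => (y.1.1 == 0) && ~~ has id y.2.2).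
  apply: PT_and; first by apply: PT_eq0; pt_proj.
  apply: PT_neg; apply: (PT_has (h := fun z : T * bool => z.2)); pt_proj.
have H2 : PT (fun y : T =>
    foldl (fun k (c : bool) => uphalf (k - c)) y.1.1 y.2.2 == 0).
  apply: PT_eq0.
  have Hl : PT (fun y : T => y.2.2) by pt_proj.
  have Hb : PT (fun y : T => y.1.1) by pt_proj.
  apply: PT_ext (PT_foldl_add (f := fun x : T * (bool * nat) =>
    uphalf (if x.2.1 then x.2.2.-1 else x.2.2)) (g := fun=> 2) Hl Hb _ _ _) _.
  - by apply: PT_uphalf; apply: PT_if; [pt_proj | apply: PT_predn;
      pt_proj | pt_proj].
  - by pbnd_arith.
  - by move=> e a z; rewrite !sz_nat /=; case: a; lia.
  - move=> y /=; elim: (y.2.2) (y.1.1) => //= c b IH k; rewrite IH.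
    by case: c; rewrite ?subn1 ?subn0.
have H : PT (fun y : T => if y.2.1 then (y.1.1 == 0) && ~~ has id y.2.2
    else foldl (fun k (c : bool) => uphalf (k - c)) y.1.1 y.2.2 == 0).
  by apply: PT_if => //; pt_proj.
have Hl : PT (fun x : nat * seq bool => x.2) by pt_proj.
exact: (PT_case_seq Hl (PT_const false) H).
Qed.

Lemma PT_disjoint_sets :
  PT (fun x : vset * seq (vset * vset) => disjoint_sets x.1 x.2).
Proof.
have H : PT (fun x : vset * seq (vset * vset) =>
  flatten (map undup (x.1 :: flatten [seq [:: d.1; d.2] | d <- x.2]))).
  apply: PT_flatten_map; first by apply: PT_undup PT_id.
  apply: PT_cons; first by pt_proj.
  apply: (PT_flatten_map (f := fun d : vset * vset => [:: d.1; d.2]));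
    last by pt_proj.
  by do 2!(apply: PT_cons; first by pt_proj); exact: PT_const.
apply: PT_ext (PT_eqop (PT_undup H) H) _ => x.
by rewrite /disjoint_sets; apply/eqP/idP => [<-|/undup_id //];
  apply: undup_uniq.
Qed.

Lemma PT_picks :
  PT (fun x : seq (vset * vset) * seq sym => flatten (picks x.1 x.2)).
Proof.
pose T := (seq (vset * vset) * seq sym)%type.
pose f (x : T * ((vset * vset) * (seq sym * vset))) :=
  (behead x.2.2.1, x.2.2.2 ++ pick1 x.2.2.1 x.2.1).
have Hf : PT f.
  apply: PT_pair; first by apply: PT_behead; pt_proj.
  apply: PT_cat; first by pt_proj.
  apply: PT_if; try by pt_proj.
  by apply: PT_eqop; [apply: PT_head; pt_proj | exact: PT_const].
have Hl : PT (fun x : T => x.1) by pt_proj.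
have Hb : PT (fun x : T => (x.2, [::] : vset)) by apply: PT_pair;
  [pt_proj | exact: PT_const].
apply: PT_ext (PT_snd (PT_foldl_add (f := f) (g := fun x : T * (vset * vset) =>
  sz x) Hl Hb Hf _ _)) _.
- by pbnd_arith.
- move=> e d [u z].
  have -> : f (e, (d, (u, z))) = (behead u, z ++ pick1 u d) by [].
  rewrite !sz_pair sz_cat.
  have : sz (behead u) <= sz u by exact: sz_behead.
  have : sz (pick1 u d) <= sz d.
    by case: d => d1 d2; rewrite /pick1 sz_pair; case: ifP => _ /=; lia.
  lia.
- case=> D u /=; rewrite /f.
  suff H z : (foldl (fun z a => (behead z.1, z.2 ++ pick1 z.1 a)) (u, z) D).2 =
      z ++ flatten (picks D u) by rewrite (H [::]).
  elim: D u z => [|d D IH] u z; first by rewrite cats0.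
  by rewrite /= IH catA.
Qed.
End PTChecks.

(** * Sizes of codes and encodings *)

Lemma sz_bits (u : seq bool) : sz u <= 4 * size u + 1.
Proof.
elim: u => // b u IH; rewrite sz_cons [size (b :: u)](_ : _ = (size u).+1) //.
have : sz b <= 3 by exact: sz_bool.
lia.
Qed.

Lemma sumn_subseq (T : eqType) (f : T -> nat) (s t : seq T) :
  subseq s t -> sumn (map f s) <= sumn (map f t).
Proof.
elim: t s => [|y t IH] [|x s] //=; case: eqP => [->|_] /IH //=; lia.
Qed.

Lemma size_brackets x : size (brackets x) = (size x).+2.
Proof. by rewrite /= size_rcons. Qed.

Definition code_ratio (r : nat) : nat := 2 * #|'I_r| + 10.

Section SizeCodes.
Variable r : nat.
Local Notation K := (code_ratio r).
Local Notation vset := (seq (celem r)).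

Definition sz_linear (A : Type) (cA : code A) (f : A -> seq sym) : Prop :=
  forall a, (sz a).+1 <= K * size (f a).
Arguments sz_linear {A cA} f.

Lemma sz_linear_flatten (A : Type) (cA : code A) (f : A -> seq sym) l :
  sz_linear f -> sz l <= K * size (flatten (map f l)) + 1.
Proof.
move=> H; elim: l => [|a l IH]; first exact: leq_addl.
rewrite sz_cons [flatten _](_ : _ = f a ++ flatten (map f l)) // size_cat
  mulnDr.
by have := H a; lia.
Qed.

Lemma sz_linear_seq (A : Type) (cA : code A) (f : A -> seq sym) :
  sz_linear f -> sz_linear (fun l => brackets (flatten (map f l))).
Proof.
move=> H l; rewrite size_brackets; have := sz_linear_flatten l H.
rewrite /code_ratio; set m := 2 * _; rewrite 2!mulnS; nia.
Qed.

Lemma sz_enc_word (u : word) : (sz u).+3 <= K * size (enc_word u).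
Proof.
rewrite size_brackets size_map; move: (sz_bits u).
move: (sz u) (size u) => x y; rewrite /code_ratio; set m := 2 * _; nia.
Qed.

Lemma sz_linear_enc_word : sz_linear enc_word.
Proof. by move=> u; apply: leq_trans (sz_enc_word u); rewrite leqW ?leqnSn. Qed.

Lemma sz_enc_tuple (i : 'I_r) (t : seq word) :
  (@sz _ (code_fin 'I_r) i + sz t + 6) <=
  K * size (brackets (enc_word (nseq i true) ++ flatten (map enc_word t))).
Proof.
have := sz_fin i; have := sz_linear_flatten t sz_linear_enc_word.
rewrite size_brackets size_cat size_brackets.
move: (size (flatten _)) (size (map _ (nseq _ _))) (sz t) (sz i) => a b x y.
rewrite /code_ratio; set m := #|_|; nia.
Qed.

Lemma sz_linear_enc_celem : sz_linear (@enc_celem r).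
Proof.
case=> [u|[i t]]; first exact: sz_enc_word.
apply: leq_trans (sz_enc_tuple i t).
have le x y : (3 + (x + y).+1).+2 <= x + y + 6 by lia.
exact: le.
Qed.

Lemma sz_linear_enc_set : sz_linear (@enc_set r).
Proof. exact: sz_linear_seq sz_linear_enc_celem. Qed.

Lemma sz_linear_enc_deps : sz_linear (@enc_deps r).
Proof.
apply: (sz_linear_seq (f := fun d : vset * vset => enc_set d.1 ++ enc_set d.2)).
move=> [s t]; rewrite sz_pair size_cat mulnDr.
have := sz_linear_enc_set s; have := sz_linear_enc_set t; rewrite /=; lia.
Qed.

Lemma size_enc_set_subseq (s t : vset) :
  subseq s t -> size (enc_set s) <= size (enc_set t).
Proof.
move=> st; rewrite !size_brackets !size_flatten /shape -!map_comp !ltnS.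
exact: sumn_subseq.
Qed.

Lemma size_enc_set_cat (s t : vset) :
  size (enc_set (s ++ t)) + 2 = size (enc_set s) + size (enc_set t).
Proof. rewrite !size_brackets map_cat flatten_cat size_cat; lia. Qed.

Lemma size_enc_set_picks D u :
  size (enc_set (flatten (@picks r D u))) <= size (enc_deps D).
Proof.
rewrite !size_brackets !ltnS.
elim: D u => // d D IH u.
rewrite [leqLHS](_ : _ = size (flatten (map (@enc_celem r) (pick1 u d))) +
  size (flatten (map (@enc_celem r) (flatten (picks D (behead u))))));
    last first.
  by rewrite /= map_cat flatten_cat size_cat.
rewrite [leqRHS](_ : _ = size (enc_set d.1) + size (enc_set d.2) +
  size (flatten [seq enc_set d.1 ++ enc_set d.2 | d <- D])); last first.
  by rewrite -!size_cat.
apply: leq_add; last exact: IH.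
by rewrite /pick1; case: ifP => _; rewrite !size_brackets; lia.
Qed.
End SizeCodes.

(** * The verifier *)

Section Verifier.
Variables (P : comb_problem) (c : nat) (F : seq sym -> seq sym -> bool).
Hypothesis PT_F : PT (fun x : seq sym * seq sym => F x.1 x.2).
Hypothesis FP : forall x, feasible_lang P x <-> exists u, F x u.
Local Notation r := (nrel P).
Local Notation vset := (seq (celem r)).
#[local] Existing Instance code_elem.

Definition check_solution (E s : vset) (u : seq sym) : bool :=
  F (enc_set (scenario_seq E) ++ enc_set s) u.

Lemma check_solution_sound E s u : check_solution E s u ->
  feasible (scenario (to_fset E)) (to_fset s).
Proof.
move=> H; have [_ /(_ (ex_intro _ u H))] := FP (enc_set (scenario_seq E) ++
  enc_set s).
move=> [R [s' [e _ fs]]]; rewrite -to_fset_scenario.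
have [-> e2] := prefix_free_set e.
have [-> _] := @prefix_free_set _ s s' [::] [::]
  (etrans (cats0 _) (etrans e2 (esym (cats0 _)))).
exact: fs.
Qed.

Lemma check_solution_complete E s : feasible (scenario (to_fset E)) s ->
  exists (l : vset) u, [/\ to_fset l = s,
    size (enc_set l) <= size (enc_set E) & check_solution E l u].
Proof.
move=> fs; pose l := [seq e <- undup (scenario_seq E) | e \in s].
have el : to_fset l = s.
  apply/fsetP => e; rewrite in_to_fset mem_filter mem_undup.
  case es : (e \in s) => //=.
  have /fsubsetP /(_ e es) := feasible_sub (@scenario_instance _ _) fs.
  by rewrite -to_fset_scenario in_to_fset.
have /FP [u Fu] : feasible_lang P (enc_set (scenario_seq E) ++ enc_set l).
  exists (scenario_seq E), l; split=> //; rewrite to_fset_scenario ?el //.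
  exact: scenario_instance.
exists l, u; split=> //.
apply: size_enc_set_subseq; apply: subseq_trans (filter_subseq _ _) _.
exact: subseq_trans (undup_subseq _) (filter_subseq _ _).
Qed.

Definition first_guess : Type :=
  (vset * (vset * (seq (vset * vset) * (seq bool * (vset * seq sym)))))%type.
Definition last_guess : Type := (vset * seq sym)%type.

(* The input [w] is not parsed: the first guess contains its components, which
   are encoded again. *)
Definition check (w u : seq sym) (x : first_guess) (y : last_guess) : bool :=
  let: (E0, (E', (D, (b, (s0, u0))))) := x in
  let E := E' ++ flatten (picks D u) in
  [&& w == enc_set E0 ++ enc_set E' ++ enc_deps D ++ enc_word b,
      disjoint_sets E' D, size D <= c * size w, check_solution E0 s0 u0,
      check_solution E y.1 y.2 & le_bits (hdist s0 y.1) b].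

Definition verifier (xs : seq (seq sym)) : bool :=
  if dec (A := first_guess) (ptree (nth [::] xs 1)) is Some x then
    if dec (A := last_guess) (ptree (nth [::] xs 3)) is Some y then
      check (nth [::] xs 0) (nth [::] xs 2) x y
    else false
  else false.

Lemma PT_check :
  PT (fun z : (seq sym * seq sym) * (first_guess * last_guess) =>
        check z.1.1 z.1.2 z.2.1 z.2.2).
Proof.
pose T := ((seq sym * seq sym) * (first_guess * last_guess))%type.
pose E0 (z : T) : vset := z.2.1.1.
pose E' (z : T) : vset := z.2.1.2.1.
pose D (z : T) : seq (vset * vset) := z.2.1.2.2.1.
pose b (z : T) : seq bool := z.2.1.2.2.2.1.
pose s0 (z : T) : vset := z.2.1.2.2.2.2.1.
pose u0 (z : T) : seq sym := z.2.1.2.2.2.2.2.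
pose s (z : T) : vset := z.2.2.1.
pose u (z : T) : seq sym := z.2.2.2.
pose E (z : T) : vset := E' z ++ flatten (picks (D z) z.1.2).
have HE0 : PT E0 by rewrite /E0; pt_proj.
have HE' : PT E' by rewrite /E'; pt_proj.
have HD : PT D by rewrite /D; pt_proj.
have Hb : PT b by rewrite /b; pt_proj.
have Hs0 : PT s0 by rewrite /s0; pt_proj.
have Hu0 : PT u0 by rewrite /u0; pt_proj.
have Hs : PT s by rewrite /s; pt_proj.
have Hu : PT u by rewrite /u; pt_proj.
have HE : PT E.
  apply: PT_cat => //.
  apply: (PT_comp (@PT_picks r) (g := fun z : T => (D z, z.1.2))).
  by apply: PT_pair => //; pt_proj.
have Hsol (A B : T -> vset) (v : T -> seq sym) : PT A -> PT B -> PT v ->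
    PT (fun z => check_solution (A z) (B z) (v z)).
  move=> HA HB Hv.
  apply: (PT_comp PT_F (g := fun z : T => (enc_set (scenario_seq (A z)) ++
    enc_set (B z), v z))).
  apply: PT_pair => //; apply: PT_cat; last exact: PT_comp (@PT_enc_set r) HB.
  exact: PT_comp (@PT_enc_set r) (PT_comp (@PT_scenario r) HA).
have H : PT (fun z : T =>
  [&& z.1.1 == enc_set (E0 z) ++ enc_set (E' z) ++ enc_deps (D z) ++
    enc_word (b z),
      disjoint_sets (E' z) (D z), size (D z) <= c * size z.1.1,
      check_solution (E0 z) (s0 z) (u0 z),
      check_solution (E z) (s z) (u z) & le_bits (hdist (s0 z) (s z)) (b z)]).
  apply: PT_and.
    apply: PT_eqop; first by pt_proj.
    apply: PT_cat; first exact: PT_comp (@PT_enc_set r) HE0.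
    apply: PT_cat; first exact: PT_comp (@PT_enc_set r) HE'.
    apply: PT_cat; first exact: PT_comp (@PT_enc_deps r) HD.
    exact: PT_comp PT_enc_word Hb.
  apply: PT_and.
    by apply: (PT_comp (@PT_disjoint_sets r) (g := fun z : T => (E' z, D z)));
      apply: PT_pair.
  apply: PT_and.
    apply: PT_leq; first exact: PT_size.
    by apply: PT_muln (PT_const c) _; apply: PT_size; pt_proj.
  apply: PT_and; first exact: Hsol.
  apply: PT_and; first exact: Hsol.
  apply: (PT_comp PT_le_bits (g := fun z : T => (hdist (s0 z) (s z), b z))).
  apply: PT_pair => //.
  by apply: (PT_comp (@PT_hdist r) (g := fun z : T => (s0 z, s z)));
    apply: PT_pair.
by apply: PT_ext H _ => -[[w v] [[x1 [x2 [x3 [x4 [x5 x6]]]]] y]].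
Qed.

Lemma PT_verifier : PT verifier.
Proof.
have Hcel : PT (dec (A := celem r)).
  apply: PT_dec_sum; first exact: PT_dec_seq PT_dec_bool.
  by apply: PT_dec_pair; [exact: PT_dec_fin | do 2!apply: PT_dec_seq;
    exact: PT_dec_bool].
have Hset : PT (dec (A := vset)) by exact: PT_dec_seq Hcel.
have Hstr : PT (dec (A := seq sym)) by apply: PT_dec_seq; exact: PT_dec_fin.
have H1 : PT (dec (A := first_guess)).
  apply: PT_dec_pair => //; apply: PT_dec_pair => //.
  apply: PT_dec_pair; first by apply: PT_dec_seq; apply: PT_dec_pair.
  apply: PT_dec_pair; first by apply: PT_dec_seq; exact: PT_dec_bool.
  exact: PT_dec_pair.
have H3 : PT (dec (A := last_guess)) by exact: PT_dec_pair.
pose T := seq (seq sym).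
have Hp i : PT (fun xs : T => ptree (nth [::] xs i)).
  by apply: PT_comp PT_ptree _; apply: PT_nth PT_id.
have Hc : PT (fun z : T * first_guess * last_guess =>
    check (nth [::] z.1.1 0) (nth [::] z.1.1 2) z.1.2 z.2).
  apply: (PT_comp PT_check (g := fun z : T * first_guess * last_guess =>
    ((nth [::] z.1.1 0, nth [::] z.1.1 2), (z.1.2, z.2)))).
  apply: PT_pair; last by pt_proj.
  by apply: PT_pair; apply: PT_nth; pt_proj.
have H2 : PT (fun z : T * first_guess =>
    if dec (A := last_guess) (ptree (nth [::] z.1 3)) is Some y then
      check (nth [::] z.1 0) (nth [::] z.1 2) z.2 y else false).
  apply: (PT_case_option _ (PT_const false) Hc).
  apply: PT_comp H3 _; apply: (PT_comp (Hp 3)); pt_proj.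
apply: (PT_case_option _ (PT_const false) H2).
exact: PT_comp H1 (Hp 1).
Qed.
End Verifier.

Lemma size_enc_deps r D : size D <= size (@enc_deps r D).
Proof.
rewrite size_brackets;
  apply: (@leq_trans
    (size (flatten [seq enc_set d.1 ++ enc_set d.2 | d <- D]))); last by lia.
elim: D => // d D IH; rewrite [leqRHS](_ : _ = size (enc_set d.1 ++ enc_set d.2)
  +
  size (flatten [seq enc_set d.1 ++ enc_set d.2 | d <- D]));
    last by rewrite -size_cat.
by rewrite -[leqLHS]add1n; apply: leq_add IH; rewrite size_cat size_brackets.
Qed.

Definition guess_bound (r d n : nat) : nat :=
  5 * (code_ratio r * n) + (((2 * n) ^ d + d) * letter_max + 6) + n.

Lemma ispoly_guess_bound r d : ispoly (guess_bound r d).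
Proof.
have Pc k : ispoly (fun=> k) by exact: ispoly_const.
have Pn := ispoly_id.
have P2 : ispoly (fun n => 2 * n) by apply: ispoly_mul.
have PX : ispoly (fun n => (2 * n) ^ d) by apply: ispoly_exp.
by do ?[apply: ispoly_add | apply: ispoly_mul | exact: PX | exact: Pc |
  exact: Pn].
Qed.

Section Bounds.
Variables (P : comb_problem) (d : nat) (F : seq sym -> seq sym -> bool).
Hypothesis F_size : forall x u, F x u -> size u <= size x ^ d + d.
Local Notation r := (nrel P).
Local Notation vset := (seq (celem r)).
Local Notation K := (code_ratio r).

Lemma sz_set_le n (E : vset) : size (enc_set E) <= n -> sz E <= K * n.
Proof.
by move=> le; apply: leq_trans (ltnW (sz_linear_enc_set E)) _; rewrite leq_mul2l
  le orbT.
Qed.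

Lemma sz_certificate n (E s : vset) u : check_solution F E s u ->
  size (enc_set E) <= n -> size (enc_set s) <= n ->
  sz u <= ((2 * n) ^ d + d) * letter_max + 1.
Proof.
move=> /F_size su sE ss; apply: leq_trans (sz_word u) _.
rewrite leq_add2r leq_mul2r; apply/orP; right; apply: leq_trans su _.
rewrite leq_add2r; apply: (ispoly_mono (ispoly_exp d ispoly_id)).
rewrite size_cat mul2n -addnn; apply: leq_add => //.
by apply: leq_trans sE; apply: size_enc_set_subseq; apply: filter_subseq.
Qed.

Lemma size_first_guess n (x : first_guess P) :
  let: (E0, (E', (D, (b, (s0, u0))))) := x in
  size (enc_set E0 ++ enc_set E' ++ enc_deps D ++ enc_word b) <= n ->
  size (enc_set s0) <= size (enc_set E0) -> check_solution F E0 s0 u0 ->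
  size (str bool (enc x)) <= guess_bound r d n.
Proof.
case: x => E0 [E' [D [b [s0 u0]]]]; rewrite !size_cat => le s0E0 c0.
have H0 : sz E0 <= K * n by apply: sz_set_le; lia.
have H1 : sz E' <= K * n by apply: sz_set_le; lia.
have H2 : sz s0 <= K * n by apply: sz_set_le; lia.
have H3 : sz D <= K * n.
  by apply: leq_trans (ltnW (sz_linear_enc_deps D)) _; rewrite leq_mul2l; lia.
have H4 : sz b <= K * n.
  by apply: leq_trans (ltnW (sz_linear_enc_word r b)) _; rewrite leq_mul2l; lia.
have H5 : sz u0 <= ((2 * n) ^ d + d) * letter_max + 1.
  by apply: sz_certificate c0 _ _; lia.
rewrite size_str -/(sz _) !sz_pair /guess_bound; lia.
Qed.

Lemma size_last_guess n (y : last_guess P) E :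
  size (enc_set E) <= n -> size (enc_set y.1) <= size (enc_set E) ->
  check_solution F E y.1 y.2 ->
  size (str bool (enc y)) <= guess_bound r d n.
Proof.
case: y => s u le sE cu.
have H0 : sz s <= K * n by apply: sz_set_le; apply: leq_trans sE le.
have H1 : sz u <= ((2 * n) ^ d + d) * letter_max + 1.
  by apply: (sz_certificate cu le); apply: leq_trans sE le.
rewrite size_str -/(sz _) !sz_pair /guess_bound; lia.
Qed.
End Bounds.

Theorem theorem14 (P : comb_problem) (hP : problem_in_NP P) (c : nat) :
  in_Sigma 3 (HDRR_xor_lang P c).
Proof.
have [F [d0 [PF Fsz FP]]] := in_NP_PT hP.2.
have [M HM HMv] := PT_decided 4 (PT_verifier P c PF).
have [d Hd] := ispoly_leXD (ispoly_guess_bound (nrel P) d0).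
exists M => //; exists d => w; set q := size w ^ d + d.
have Hq : guess_bound (nrel P) d0 (size w) <= q by exact: Hd.
split.
  move=> [E0 [E' [D [sg [b [ew dis sD [s0 fs0 Hs]]]]]]].
  have [l0 [u0 [el0 sl0 c0]]] := check_solution_complete FP fs0.
  pose x : first_guess P := (E0, (E', (D, (sg :: b, (l0, u0))))).
  exists (str bool (enc x)); split.
    apply: leq_trans Hq; apply: (@size_first_guess _ _ _ Fsz (size w) x _ _
      c0) => //.
    by rewrite -ew.
  move=> u2 _.
  have [s fs dist] := Hs _ (picks_scenario E' D u2).
  have [l [u [el sl cu]]] := check_solution_complete FP fs.
  pose y : last_guess P := (l, u).
  exists (str bool (enc y)); split.
    apply: leq_trans Hq; apply: (@size_last_guess _ _ _ Fsz (size w) y _ _ sl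
      cu).
    have := size_enc_set_cat E' (flatten (picks D u2)).
    have := size_enc_set_picks D u2; rewrite ew !size_cat; lia.
  apply/HMv => //; rewrite /verifier.
  rewrite -[nth _ _ 1]/(str bool (enc x)) -[nth _ _ 3]/(str bool (enc y)).
  rewrite !ptreeK !encK; apply/and5P; split=> //; first exact/eqP.
    by rewrite disjoint_setsE.
  by rewrite cu le_bitsE -hammingE el0 el.
move=> [u1 [_ H]].
have [u3 [_ ]] := H [::] isT.
move=> /(HMv [:: w; u1; [::]; u3] (erefl _)).
rewrite /verifier -[nth _ _ 1]/u1 -[nth _ _ 0]/w.
case e1 : (dec _) => [[E0 [E' [D [b [s0 u0]]]]]|] //.
case: (dec _) => [y|] // /and5P [/eqP ew dis sD c0 /andP [_ hb]].
case: b e1 ew hb => [|sg b] // e1 ew _.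
exists E0, E', D, sg, b; split=> //; first by rewrite -disjoint_setsE.
exists (to_fset s0); first exact: check_solution_sound c0.
move=> A /scenario_picks [u2 su2 ->].
have su2q : size u2 <= q.
  rewrite su2; apply: leq_trans (size_enc_deps D) _.
  apply: leq_trans Hq; rewrite /guess_bound ew !size_cat; lia.
have [u3' [_ ]] := H u2 su2q.
move=> /(HMv [:: w; u1; u2; u3'] (erefl _)).
rewrite /verifier -[nth _ _ 1]/u1 -[nth _ _ 2]/u2 e1.
case: (dec _) => [[s u]|] // /and5P [_ _ _ _ /andP [cu hb]].
exists (to_fset s); first exact: check_solution_sound cu.
by rewrite hammingE -le_bitsE.
Qed.
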